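(* Let $M$ be a loopless sparse paving matroid of rank $d$ on $m+d$ elements, with $m,d\geq 1$ and $\lambda$ circuit-hyperplanes. Then $M$ is degenerate if and only if either $$m=1,\quad d\geq 3\text{ is odd},\quad \lambda=1,$$ or $(m,d,\lambda)=(4,3,7)$.
   Context: A matroid of rank $d$ is paving if every circuit has at least $d$ elements; it is sparse paving if both it and its dual are paving. A circuit-hyperplane is a subset of the ground set that is both a circuit and a hyperplane. For a loopless matroid $M$, let $L(M)$ be its lattice of flats, $\chi_M(t)$ its characteristic polynomial and $\operatorname{rk}M$ its rank. The Kazhdan--Lusztig polynomials $P_M(t)\in\mathbb Z[t]$ of loopless matroids are uniquely determined by: (i) $P_M(t)=1$ if $\operatorname{rk}M=0$; (ii) $\deg P_M(t)<\operatorname{rk}M/2$ if $\operatorname{rk}M>0$; (iii) $t^{\operatorname{rk}M}P_M(t^{-1})=\sum_{F\in L(M)}\chi_{M_F}(t)P_{M^F}(t)$, where $M_F$ is the restriction of $M$ to $F$ and $M^F$ is the contraction of $M$ by $F$. A loopless matroid $M$ of positive rank $d$ is non-degenerate if $\deg P_M(t)=\lfloor (d-1)/2\rfloor$, and degenerate otherwise. *)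

(* Defs.v *)
From HB Require Import structures.
From mathcomp Require Import all_boot all_order all_algebra.

Set Implicit Arguments.
Unset Strict Implicit.
Unset Printing Implicit Defensive.

Import GRing.Theory.
Local Open Scope ring_scope.

(* A matroid is given by its ground set [E : {set T}] and its rank function.
   The ground set is a subset of [T], not [T] itself, so that all minors of a
   matroid live in one type.  The rank function is defined on all of
   [{set T}]; the first axiom makes its values off [powerset E] redundant, so
   that equality of matroids is equality of ground sets and of ranks. *)
Definition matroid_axiom (T : finType) (E : {set T})
    (r : {ffun {set T} -> nat}) : bool :=
  [&& [forall A : {set T}, r A == r (A :&: E)],
      [forall A : {set T}, r A <= #|A|]%N,
      [forall A : {set T}, forall B : {set T},
         (A \subset B) ==> (r A <= r B)%N]
    & [forall A : {set T}, forall B : {set T},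
         r (A :|: B) + r (A :&: B) <= r A + r B]%N].

Record matroid (T : finType) := Matroid {
  ground : {set T};
  rank_fun : {ffun {set T} -> nat};
  matroidP : matroid_axiom ground rank_fun
}.

Definition rk (T : finType) (M : matroid T) (A : {set T}) : nat :=
  rank_fun M A.
Definition rank (T : finType) (M : matroid T) : nat := rk M (ground M).

Lemma rkI (T : finType) (M : matroid T) A : rk M A = rk M (A :&: ground M).
Proof. by have /and4P[/forallP/(_ A)/eqP] := matroidP M. Qed.

Lemma rk_card (T : finType) (M : matroid T) A : (rk M A <= #|A|)%N.
Proof. by have /and4P[_ /forallP/(_ A)] := matroidP M. Qed.

Lemma rkS (T : finType) (M : matroid T) (A B : {set T}) :
  A \subset B -> (rk M A <= rk M B)%N.
Proof.
by have /and4P[_ _ /forallP/(_ A)/forallP/(_ B)/implyP] := matroidP M.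
Qed.

Lemma rk_submod (T : finType) (M : matroid T) (A B : {set T}) :
  (rk M (A :|: B) + rk M (A :&: B) <= rk M A + rk M B)%N.
Proof. by have /and4P[_ _ _ /forallP/(_ A)/forallP/(_ B)] := matroidP M. Qed.

Lemma matroid_eq (T : finType) (M N : matroid T) :
  ground M = ground N -> rk M =1 rk N -> M = N.
Proof.
case: M N => [E r p] [E' r' p'] /= eE er; rewrite /rk /= in er.
have {}er : r = r' by apply/ffunP.
by case: _ / eE in p' *; case: _ / er in p' *; rewrite (bool_irrelevance p p').
Qed.

Lemma rk0 (T : finType) (M : matroid T) : rk M set0 = 0%N.
Proof. by apply/eqP; rewrite -leqn0 -[leqRHS](@cards0 T) rk_card. Qed.

Lemma restrict_subproof (T : finType) (M : matroid T) (X : {set T}) :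
  matroid_axiom (ground M :&: X) [ffun A => rk M (A :&: X)].
Proof.
apply/and4P; split; apply/forallP=> A.
- rewrite !ffunE [rk M (A :&: X)]rkI; apply/eqP; congr (rk M _).
  by apply/setP=> x; rewrite !inE; do 3!case: (x \in _).
- by rewrite ffunE (leq_trans (rk_card _ _)) // subset_leq_card // subsetIl.
- by apply/forallP=> B; apply/implyP=> sAB; rewrite !ffunE rkS // setSI.
- apply/forallP=> B; rewrite !ffunE setIUl.
  by rewrite -[X in A :&: B :&: X]setIid setIACA rk_submod.
Qed.

Definition restrict (T : finType) (M : matroid T) (X : {set T}) : matroid T :=
  Matroid (restrict_subproof M X).

Lemma contract_subproof (T : finType) (M : matroid T) (X : {set T}) :
  matroid_axiom (ground M :\: X) [ffun A => rk M (A :|: X) - rk M X]%N.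
Proof.
have rX A : (rk M X <= rk M (A :|: X))%N by rewrite rkS // subsetUr.
apply/and4P; split; apply/forallP=> A.
- rewrite !ffunE [rk M (A :|: X)]rkI [rk M (_ :&: _ :|: X)]rkI.
  apply/eqP; congr (rk M _ - _)%N; apply/setP=> x; rewrite !inE.
  by do 3!case: (x \in _).
- rewrite ffunE leq_subLR addnC.
  have := rk_submod M A X => /(leq_trans (leq_addr _ _))/leq_trans; apply.
  by rewrite leq_add2r rk_card.
- apply/forallP=> B; apply/implyP=> sAB; rewrite !ffunE leq_sub2r //.
  by rewrite rkS // setSU.
- apply/forallP=> B; rewrite !ffunE -(leq_add2r (rk M X + rk M X)).
  rewrite addnACA [leqRHS]addnACA !subnK // -[X in A :|: B :|: X]setUid.
  by rewrite setUACA setUIl rk_submod.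
Qed.

Definition contract (T : finType) (M : matroid T) (X : {set T}) : matroid T :=
  Matroid (contract_subproof M X).

Lemma dual_le (T : finType) (M : matroid T) (A : {set T}) :
  (rank M <= #|A :&: ground M| + rk M (ground M :\: A))%N.
Proof.
have := rk_submod M (A :&: ground M) (ground M :\: A).
rewrite setIC setID => /(leq_trans (leq_addr _ _))/leq_trans; apply.
by rewrite leq_add2r rk_card.
Qed.

Lemma dual_subproof (T : finType) (M : matroid T) :
  matroid_axiom (ground M)
    [ffun A => #|A :&: ground M| + rk M (ground M :\: A) - rank M]%N.
Proof.
set E := ground M.
apply/and4P; split; apply/forallP=> A.
- by rewrite !ffunE -setIA setIid setDIr setDv setU0.
- rewrite ffunE leq_subLR addnC leq_add //; last first.
    by rewrite subset_leq_card // subsetIl.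
  by rewrite rkS // subsetDl.
- apply/forallP=> B; apply/implyP=> sAB; rewrite !ffunE leq_sub2r //.
  have eB : B :&: E = (A :&: E) :|: (E :&: (B :\: A)).
    apply/setP=> x; rewrite !inE; have := subsetP sAB x.
    by case: (x \in A) => [/(_ isT) ->|_]; do ?case: (x \in _).
  have eD : E :\: A = (E :\: B) :|: (E :&: (B :\: A)).
    apply/setP=> x; rewrite !inE; have := subsetP sAB x.
    by case: (x \in A) => [/(_ isT) ->|_]; do ?case: (x \in _).
  have dj : [disjoint A :&: E & E :&: (B :\: A)].
    rewrite -setI_eq0; apply/eqP/setP=> x; rewrite !inE.
    by do 3!case: (x \in _).
  rewrite eB cardsU (eqP (_ : A :&: E :&: _ == set0)) ?setI_eq0 //.
  rewrite cards0 subn0 -addnA leq_add2l eD addnC.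
  have := rk_submod M (E :\: B) (E :&: (B :\: A)).
  move=> /(leq_trans (leq_addr _ _))/leq_trans; apply.
  by rewrite leq_add2l rk_card.
- apply/forallP=> B; rewrite !ffunE -(leq_add2r (rank M + rank M)).
  rewrite addnACA [leqRHS]addnACA !subnK ?dual_le //.
  rewrite addnACA [leqRHS]addnACA leq_add //.
    by rewrite setIUl -[E in A :&: B :&: E]setIid setIACA cardsUI.
  by rewrite setDUr setDIr addnC rk_submod.
Qed.

Definition dual (T : finType) (M : matroid T) : matroid T :=
  Matroid (dual_subproof M).

Definition dependent (T : finType) (M : matroid T) (A : {set T}) : bool :=
  (A \subset ground M) && (rk M A < #|A|)%N.

Definition circuit (T : finType) (M : matroid T) (C : {set T}) : bool :=
  minset (dependent M) C.

Definition flat (T : finType) (M : matroid T) (F : {set T}) : bool :=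
  (F \subset ground M) &&
  [forall x in ground M :\: F, rk M F < rk M (x |: F)]%N.

Definition flats (T : finType) (M : matroid T) : {set {set T}} :=
  [set F | flat M F].

Definition hyperplane (T : finType) (M : matroid T) (H : {set T}) : bool :=
  flat M H && ((rk M H).+1 == rank M).

Definition circuit_hyperplanes (T : finType) (M : matroid T) :
    {set {set T}} :=
  [set A | circuit M A && hyperplane M A].

Definition loopless (T : finType) (M : matroid T) : bool :=
  [forall x in ground M, ~~ circuit M [set x]].

Definition paving (T : finType) (M : matroid T) : bool :=
  [forall C, circuit M C ==> (rank M <= #|C|)%N].

Definition sparse_paving (T : finType) (M : matroid T) : bool :=
  paving M && paving (dual M).

(* Moebius function of a family [L] ordered by inclusion.  The fuel [#|G|]
   suffices since [H \proper G] forces [#|H| < #|G|]. *)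
Fixpoint moebius_rec (T : finType) (L : {set {set T}}) (n : nat)
    (F G : {set T}) : int :=
  if F == G then 1
  else if n is n'.+1 then
    - \sum_(H in L | (F \subset H) && (H \proper G)) moebius_rec L n' F H
  else 0.

Definition moebius (T : finType) (L : {set {set T}}) (F G : {set T}) : int :=
  moebius_rec L #|G| F G.

(* For a loopless matroid, the least flat is [set0]. *)
Definition charpoly (T : finType) (M : matroid T) : {poly int} :=
  \sum_(F in flats M) moebius (flats M) set0 F *: 'X^(rank M - rk M F).

(* [revpoly n p] is t ^ n * p (1 / t), for p of degree at most n. *)
Definition revpoly (n : nat) (p : {poly int}) : {poly int} :=
  \poly_(i < n.+1) p`_(n - i).

(* The degree bound uses that the degree of p is [(size p).-1] ([size 0 = 0]).
   The sum in the third condition only involves minors of M, hence matroids on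
   subsets of [T].  Exactly one P satisfies these conditions on loopless
   matroids: see [kl_poly_axioms] and [kl_poly_unique]. *)
Definition kl_axioms (T : finType) (P : matroid T -> {poly int}) : Prop :=
  forall M : matroid T, loopless M ->
  [/\ rank M = 0%N -> P M = 1,
      (0 < rank M)%N -> ((size (P M)).-1.*2 < rank M)%N
    & revpoly (rank M) (P M) =
      \sum_(F in flats M) charpoly (restrict M F) * P (contract M F)].

(* In the third condition, the term for [F = set0] is P M itself, and by the
   degree bound the coefficients of P M are read off from the other terms, which
   involve contractions of smaller rank only. *)
Fixpoint kl_rec (T : finType) (n : nat) (M : matroid T) : {poly int} :=
  if n is n'.+1 then
    if rank M == 0%N then 1 else
    \poly_(i < uphalf (rank M))
      (\sum_(F in flats M | F != set0)
         charpoly (restrict M F) * kl_rec n' (contract M F))`_(rank M - i)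
  else 1.

Definition kl_poly (T : finType) (M : matroid T) : {poly int} :=
  kl_rec (rank M) M.

(* [size p] is 1 + deg p; this is meant for loopless M of positive rank. *)
Definition nondegenerate (T : finType) (M : matroid T) : bool :=
  size (kl_poly M) == ((rank M).-1./2).+1.

Definition degenerate (T : finType) (M : matroid T) : bool :=
  ~~ nondegenerate M.

Lemma looplessP (T : finType) (M : matroid T) :
  reflect (forall x, x \in ground M -> rk M [set x] = 1%N) (loopless M).
Proof.
apply: (iffP forall_inP) => h x xE.
  apply/eqP; rewrite eqn_leq; have := rk_card M [set x]; rewrite cards1 => -> /=.
  rewrite lt0n; apply: contra (h x xE) => /eqP r0.
  apply/minsetP; split; first by rewrite /dependent sub1set xE r0 cards1.
  move=> B /andP[_ dB]; rewrite subset1 => /orP[/eqP //|/eqP B0].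
  by move: dB; rewrite B0 cards0.
by apply/negP => /minsetp; rewrite /dependent h // cards1 andbF.
Qed.

Lemma flatP (T : finType) (M : matroid T) (F : {set T}) :
  reflect (F \subset ground M /\
           forall x, x \in ground M -> x \notin F -> (rk M F < rk M (x |: F))%N)
          (F \in flats M).
Proof.
rewrite inE; apply: (iffP andP) => -[sF h]; split=> //.
  by move=> x xE xF; apply: (forall_inP h); rewrite inE xF.
by apply/forall_inP=> x; rewrite inE => /andP[xF xE]; apply: h.
Qed.

Lemma flats_sub (T : finType) (M : matroid T) (F : {set T}) :
  F \in flats M -> F \subset ground M.
Proof. by case/flatP. Qed.

Lemma flat_ground (T : finType) (M : matroid T) : ground M \in flats M.
Proof. by apply/flatP; split=> // x ->. Qed.

Lemma flat0 (T : finType) (M : matroid T) : loopless M -> set0 \in flats M.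
Proof.
move/looplessP=> h; apply/flatP; split; first exact: sub0set.
by move=> x xE _; rewrite setU0 h // rk0.
Qed.

Lemma restrictE (T : finType) (M : matroid T) X A :
  rk (restrict M X) A = rk M (A :&: X).
Proof. by rewrite /rk /= ffunE. Qed.

Lemma contractE (T : finType) (M : matroid T) X A :
  rk (contract M X) A = (rk M (A :|: X) - rk M X)%N.
Proof. by rewrite /rk /= ffunE. Qed.

Lemma rank_restrict (T : finType) (M : matroid T) X :
  rank (restrict M X) = rk M X.
Proof. by rewrite /rank restrictE /= -setIA setIid setIC -rkI. Qed.

Lemma rank_contract (T : finType) (M : matroid T) X :
  rank (contract M X) = (rank M - rk M X)%N.
Proof.
rewrite /rank contractE /= [in LHS]rkI; congr (rk M _ - _)%N.
by apply/setP=> x; rewrite !inE; do 2!case: (x \in _).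
Qed.

Lemma rk_lt_flat (T : finType) (M : matroid T) (F G : {set T}) :
  F \in flats M -> F \proper G -> G \subset ground M -> (rk M F < rk M G)%N.
Proof.
case/flatP=> _ h /properP[sFG [x xG xF]] sG.
apply: leq_trans (h x (subsetP sG x xG) xF) _.
by rewrite rkS // subUset sub1set xG.
Qed.

Lemma loopless_restrict (T : finType) (M : matroid T) X :
  loopless M -> loopless (restrict M X).
Proof.
move/looplessP=> h; apply/looplessP=> x; rewrite inE => /andP[xE xX].
by rewrite restrictE (setIidPl _) ?sub1set // h.
Qed.

Lemma loopless_contract (T : finType) (M : matroid T) F :
  F \in flats M -> loopless (contract M F).
Proof.
case/flatP=> _ h; apply/looplessP=> x; rewrite inE => /andP[xF xE].
rewrite contractE; apply/eqP; rewrite eqn_leq subn_gt0 h // andbT.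
rewrite leq_subLR addnC.
have := rk_submod M [set x] F => /(leq_trans (leq_addr _ _))/leq_trans; apply.
by rewrite leq_add2r -[leqRHS](cards1 x) rk_card.
Qed.

Lemma flats_restrict (T : finType) (M : matroid T) (F G : {set T}) :
  F \in flats M ->
  (G \in flats (restrict M F)) = (G \in flats M) && (G \subset F).
Proof.
move=> /flatP[sF hF]; apply/flatP/andP => [[/=]|[/flatP[sG hG] sGF]].
  rewrite subsetI => /andP[sG sGF] h; split=> //; apply/flatP; split=> // x xE xG.
  have [xF|xF] := boolP (x \in F).
    move: (h x); rewrite inE xE xF => /(_ isT xG).
    by rewrite !restrictE !(setIidPl _) // subUset sub1set xF.
  rewrite ltnNge; apply/negP=> le_r; have := hF x xE xF; rewrite ltnNge => /negP[].
  have := rk_submod M (x |: G) F.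
  rewrite -setUA (setUidPr sGF) => /leq_trans-/(_ _ (leq_add le_r (leqnn _))).
  have -> : (x |: G) :&: F = G.
    apply/setP=> y; rewrite !inE; have := subsetP sGF y.
    case: eqP => [->|_] /=; first by rewrite (negPf xF) (negPf xG).
    by case: (y \in G) => // ->.
  by rewrite addnC leq_add2l.
split=> [|x]; first by rewrite subsetI sG.
rewrite inE => /andP[xE xF] xG; rewrite !restrictE !(setIidPl _) ?hG //.
by rewrite subUset sub1set xF.
Qed.

Lemma flats_contract (T : finType) (M : matroid T) (F G : {set T}) :
  F \in flats M -> F \subset G ->
  (G :\: F \in flats (contract M F)) = (G \in flats M).
Proof.
move=> /flatP[sF hF] sFG; have eG : G :\: F :|: F = G.
  by rewrite setUC setDE setUIr setUCr setIT; apply/setUidPr.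
have sub_iff : (G :\: F \subset ground M :\: F) = (G \subset ground M).
  apply/idP/idP => [h|]; last exact: setSD.
  rewrite -eG subUset sF andbT; apply: subset_trans h _; exact: subsetDl.
apply/flatP/flatP => [[/=]|]; rewrite ?sub_iff /= => -[sG h]; split=> // x.
  move=> xE xG; have xF : x \notin F by apply: contra xG; apply: (subsetP sFG).
  have := h x; rewrite !inE (negPf xG) xE xF => /(_ isT isT).
  rewrite !contractE -setUA eG ltn_sub2rE // rkS //.
rewrite !inE => /andP[xF xE]; rewrite xF /= => xG.
by rewrite !contractE -setUA eG ltn_sub2rE ?h // rkS.
Qed.

Lemma flats_contractP (T : finType) (M : matroid T) (F : {set T}) :
  F \in flats M -> flats (contract M F) =
    [set G :\: F | G in [set G in flats M | F \subset G]].
Proof.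
move=> fF; apply/setP=> K; apply/idP/imsetP => [fK|[G]]; last first.
  by rewrite inE => /andP[fG sFG] ->; rewrite flats_contract.
have := flats_sub fK; rewrite /= subsetD => /andP[sK dK].
have eK : K = (K :|: F) :\: F.
  by rewrite setDUl setDv setU0 (setDidPl _).
exists (K :|: F) => //; rewrite inE subsetUr andbT.
by rewrite -(flats_contract fF) ?subsetUr // -eK.
Qed.

Lemma sum_contract (T : finType) (M : matroid T) (F : {set T})
    (V : nmodType) (f : {set T} -> V) :
  F \in flats M ->
  \sum_(K in flats (contract M F)) f K =
  \sum_(G in flats M | F \subset G) f (G :\: F).
Proof.
move=> fF; rewrite flats_contractP // big_imset /=.
  by apply: eq_bigl => G; rewrite inE.
move=> G H; rewrite !inE => /andP[_ sG] /andP[_ sH] e.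
by rewrite -(setID G F) -(setID H F) e (setIidPr sG) (setIidPr sH).
Qed.

Lemma sum_restrict (T : finType) (M : matroid T) (F : {set T})
    (V : nmodType) (f : {set T} -> V) :
  F \in flats M ->
  \sum_(K in flats (restrict M F)) f K =
  \sum_(G in flats M | G \subset F) f G.
Proof. by move=> fF; apply: eq_bigl => G; rewrite flats_restrict. Qed.

Lemma restrict_restrict (T : finType) (M : matroid T) (F G : {set T}) :
  F \subset G -> restrict (restrict M G) F = restrict M F.
Proof.
move=> sFG; apply: matroid_eq => [|A] /=.
  by rewrite -setIA (setIidPr sFG).
by rewrite !restrictE -setIA (setIidPl sFG).
Qed.

Lemma contract_contract (T : finType) (M : matroid T) (F G : {set T}) :
  F \subset G -> contract (contract M F) (G :\: F) = contract M G.
Proof.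
move=> sFG; have eG : G :\: F :|: F = G.
  by rewrite setUC setDE setUIr setUCr setIT; apply/setUidPr.
apply: matroid_eq => [|A] /=.
  by rewrite setDDl setUC eG.
rewrite !contractE -setUA eG subnBA ?rkS // subnK // rkS //.
by apply: subset_trans sFG (subsetUr _ _).
Qed.

Lemma restrict_contract (T : finType) (M : matroid T) (F G : {set T}) :
  F \subset G ->
  restrict (contract M F) (G :\: F) = contract (restrict M G) F.
Proof.
move=> sFG; apply: matroid_eq => [|A] /=.
  by apply/setP=> x; rewrite !inE; do 3!case: (x \in _).
rewrite restrictE !contractE !restrictE (setIidPl sFG); congr (rk M _ - _)%N.
apply/setP=> x; rewrite !inE; have := subsetP sFG x.
by case: (x \in F) => [/(_ isT) ->|_]; do ?case: (x \in _).
Qed.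

Lemma moebius_rec_fuel (T : finType) (L : {set {set T}}) m n (F G : {set T}) :
  (#|G| <= m)%N -> (#|G| <= n)%N -> moebius_rec L m F G = moebius_rec L n F G.
Proof.
elim: m n G => [|m IH] [|n] G //=; rewrite ?leqn0 => lem len; case: eqP => //.
- move=> _; rewrite big1 ?oppr0 // => H /andP[_ /andP[_ /proper_card]].
  by rewrite (eqP lem).
- move=> _; rewrite big1 ?oppr0 // => H /andP[_ /andP[_ /proper_card]].
  by rewrite (eqP len).
- move=> _; congr (- _); apply: eq_bigr => H.
  move=> /andP[_ /andP[_ /proper_card ltHG]].
  by apply: IH; rewrite -ltnS (leq_trans ltHG).
Qed.

Lemma moebiusE (T : finType) (L : {set {set T}}) (F G : {set T}) :
  moebius L F G =
  if F == G then 1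
  else - \sum_(H in L | (F \subset H) && (H \proper G)) moebius L F H.
Proof.
rewrite /moebius; case def_n: #|G| => [|n] /=; case: eqP => // _.
  rewrite big1 ?oppr0 // => H /andP[_ /andP[_ /proper_card]].
  by rewrite def_n.
congr (- _); apply: eq_bigr => H /andP[_ /andP[_ /proper_card ltHG]].
by apply: moebius_rec_fuel; rewrite // -ltnS -def_n.
Qed.

Lemma moebius_out (T : finType) (L : {set {set T}}) (F G : {set T}) :
  ~~ (F \subset G) -> moebius L F G = 0.
Proof.
move=> nsFG; rewrite moebiusE ifN; last first.
  by apply: contra nsFG => /eqP ->.
rewrite big1 ?oppr0 // => H /andP[_ /andP[sFH /proper_sub sHG]].
by rewrite (subset_trans sFH sHG) in nsFG.
Qed.

Lemma moebius_suml (T : finType) (L : {set {set T}}) (F G : {set T}) :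
  G \in L ->
  \sum_(H in L | H \subset G) moebius L F H = (F == G)%:R.
Proof.
move=> LG; rewrite (bigD1 G) /= ?LG ?subxx // moebiusE.
have eP H : [&& H \in L, H \subset G & H != G] = (H \in L) && (H \proper G).
  by rewrite properEneq [(H != G) && _]andbC.
under eq_bigl => H do rewrite -andbA eP.
case: eqVneq => [->|_].
  rewrite big1 ?addr0 // => H /andP[_ HG].
  by rewrite moebius_out //; move: HG; rewrite properE => /andP[].
rewrite [X in _ + X](bigID (fun H : {set T} => F \subset H)) /=.
rewrite [X in _ + (_ + X)]big1 ?addr0 => [|H /andP[_ /moebius_out //]].
apply/eqP; rewrite addrC subr_eq0; apply/eqP; apply: eq_bigl => H.
by rewrite -andbA [(H \proper G) && _]andbC.
Qed.

Lemma moebius_sumr (T : finType) (L : {set {set T}}) (F G : {set T}) :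
  F \in L -> G \in L ->
  \sum_(H in L | F \subset H) moebius L H G = (F == G)%:R.
Proof.
move=> LF LG; pose v (i : 'I_#|L|) : {set T} := enum_val i.
pose A : 'M[int]_#|L| := \matrix_(i, j) moebius L (v i) (v j).
pose Z : 'M[int]_#|L| := \matrix_(i, j) (v i \subset v j)%:R.
have AZ1 : A *m Z = 1%:M.
  apply/matrixP=> i j; rewrite !mxE -(inj_eq enum_val_inj).
  rewrite -(moebius_suml _ (enum_valP j)) [RHS]big_mkcondr [RHS]big_enum_val /=.
  apply: eq_bigr => k _; rewrite !mxE.
  by rewrite /v; case: (_ \subset _); rewrite ?mulr1 ?mulr0.
have /matrixP ZA1 := mulmx1C AZ1.
have := ZA1 (enum_rank_in LF F) (enum_rank_in LF G).
rewrite !mxE -(inj_eq enum_val_inj) !enum_rankK_in // => <-.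
rewrite [LHS]big_mkcondr [LHS]big_enum_val /=.
apply: eq_bigr => k _; rewrite !mxE /v !enum_rankK_in //.
by case: (_ \subset _); rewrite ?mul1r ?mul0r.
Qed.

Lemma moebius_restrict (T : finType) (M : matroid T) (F G H : {set T}) :
  F \in flats M -> H \subset F ->
  moebius (flats (restrict M F)) G H = moebius (flats M) G H.
Proof.
move=> fF; have [n] := ubnP #|H|; elim: n H => // n IH H ltHn sHF.
rewrite !(moebiusE _ G); case: eqP => // _; congr (- _).
apply: eq_big => K.
  rewrite flats_restrict //; case KH: (K \proper H); rewrite ?andbF //.
  by rewrite (subset_trans (proper_sub KH) sHF) andbT.
move=> /and3P[_ _ KH]; apply: IH.
  by rewrite (leq_trans (proper_card KH)).
by rewrite (subset_trans (proper_sub KH) sHF).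
Qed.

Lemma subset_setD2r (T : finType) (F G H : {set T}) :
  F \subset H -> F \subset G -> (H :\: F \subset G :\: F) = (H \subset G).
Proof.
move=> sFH sFG; apply/idP/idP => [h|]; last exact: setSD.
rewrite -(setID H F) subUset (setIidPr sFH) sFG.
exact: subset_trans h (subsetDl _ _).
Qed.

Lemma moebius_contract (T : finType) (M : matroid T) (F G : {set T}) :
  F \in flats M -> F \subset G ->
  moebius (flats (contract M F)) set0 (G :\: F) = moebius (flats M) F G.
Proof.
move=> fF; have [n] := ubnP #|G|; elim: n G => // n IH G ltGn sFG.
rewrite !(moebiusE _ _ (G :\: F)) (moebiusE _ F).
rewrite [set0 == _]eq_sym setD_eq0 [F == G]eqEsubset sFG /=.
case: ifP => // _; congr (- _).
rewrite big_mkcondr sum_contract // -big_mkcondr [RHS]big_mkcondr.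
rewrite [LHS]big_mkcondr [LHS]big_mkcondr; apply: eq_bigr => H _.
case sFH: (F \subset H) => //=.
rewrite sub0set /= properE !subset_setD2r // -properE.
by case: ifP => // HG; rewrite IH // (leq_trans (proper_card HG)).
Qed.

Lemma charpoly_restrict (T : finType) (M : matroid T) (F : {set T}) :
  F \in flats M ->
  charpoly (restrict M F) =
  \sum_(H in flats M | H \subset F)
     moebius (flats M) set0 H *: 'X^(rk M F - rk M H).
Proof.
move=> fF; rewrite /charpoly sum_restrict //; apply: eq_bigr => H.
move=> /andP[fH sHF].
by rewrite moebius_restrict // rank_restrict restrictE (setIidPl sHF).
Qed.

Lemma charpoly_contract (T : finType) (M : matroid T) (F : {set T}) :
  F \in flats M ->
  charpoly (contract M F) =
  \sum_(G in flats M | F \subset G)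
     moebius (flats M) F G *: 'X^(rank M - rk M G).
Proof.
move=> fF; rewrite /charpoly sum_contract //; apply: eq_bigr => G.
move=> /andP[fG sFG]; rewrite moebius_contract // rank_contract contractE.
have -> : G :\: F :|: F = G.
  by rewrite setUC -{1}(setIidPr sFG) setID.
by rewrite -subnDA subnKC // rkS.
Qed.

Lemma charpoly_restrict0 (T : finType) (M : matroid T) :
  loopless M -> charpoly (restrict M set0) = 1.
Proof.
move=> lM; have f0 := flat0 lM; rewrite charpoly_restrict //.
rewrite (bigD1 set0) /= ?sub0set ?f0 // big1 ?addr0.
  by rewrite moebiusE eqxx subnn expr0 scale1r.
by move=> H /andP[/andP[_]]; rewrite subset0 => ->.
Qed.

Lemma contract0 (T : finType) (M : matroid T) : contract M set0 = M.
Proof.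
apply: matroid_eq => [|A] /=; first by rewrite setD0.
by rewrite contractE setU0 rk0 subn0.
Qed.

Lemma coef_revpoly n p i :
  (revpoly n p)`_i = if (i <= n)%N then p`_(n - i) else 0.
Proof. by rewrite coef_poly ltnS. Qed.

Lemma revpoly_sum (I : Type) (r : seq I) (P : pred I) (f : I -> {poly int}) n :
  revpoly n (\sum_(i <- r | P i) f i) = \sum_(i <- r | P i) revpoly n (f i).
Proof.
apply/polyP=> k; rewrite coef_revpoly !coef_sum.
under [RHS]eq_bigr => i _ do rewrite coef_revpoly.
by case: ifP => // _; rewrite big1.
Qed.

Lemma revpolyZ c p n : revpoly n (c *: p) = c *: revpoly n p.
Proof.
apply/polyP=> k; rewrite coefZ !coef_revpoly coefZ.
by case: ifP; rewrite ?mulr0.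
Qed.

Lemma revpolyXn n k : (k <= n)%N -> revpoly n 'X^k = 'X^(n - k).
Proof.
move=> lekn; apply/polyP=> i; rewrite coef_revpoly !coefXn.
have [lein|ltni] := leqP i n.
  congr (nat_of_bool _)%:R; apply/eqP/eqP => [<-|->]; first by rewrite subKn.
  by rewrite subKn.
by rewrite gtn_eqF // (leq_ltn_trans (leq_subr _ _)).
Qed.

Lemma revpolyE n (p : {poly int}) : (size p <= n.+1)%N ->
  revpoly n p = \sum_(i < n.+1) p`_i *: 'X^(n - i).
Proof.
move=> sz; have {1}-> : p = \sum_(i < n.+1) p`_i *: 'X^i.
  rewrite -poly_def; apply/polyP=> i; rewrite coef_poly.
  by case: ltnP => // le; rewrite nth_default // (leq_trans sz).
rewrite revpoly_sum; apply: eq_bigr => i _.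
by rewrite revpolyZ revpolyXn // -ltnS.
Qed.

Lemma revpolyM m n (p q : {poly int}) :
  (size p <= m.+1)%N -> (size q <= n.+1)%N ->
  revpoly (m + n) (p * q) = revpoly m p * revpoly n q.
Proof.
move=> sp sq; rewrite (revpolyE sp) (revpolyE sq).
have e k (r : {poly int}) : (size r <= k)%N -> r = \sum_(i < k) r`_i *: 'X^i.
  move=> sz; rewrite -poly_def; apply/polyP=> i; rewrite coef_poly.
  by case: ltnP => // le; rewrite nth_default // (leq_trans sz).
rewrite {1}(e _ _ sp) {1}(e _ _ sq) !mulr_suml revpoly_sum.
apply: eq_bigr => i _; rewrite !mulr_sumr revpoly_sum; apply: eq_bigr => j _.
rewrite -!scalerAl -!scalerAr !revpolyZ -!exprD revpolyXn; last first.
  by rewrite leq_add // -ltnS.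
congr (_ *: (_ *: 'X^_)).
have [lei lej] : (i <= m)%N /\ (j <= n)%N by split; rewrite -ltnS.
by rewrite subnDA -addnBAC // -addnBA.
Qed.

Lemma revpolyK n (p : {poly int}) :
  (size p <= n.+1)%N -> revpoly n (revpoly n p) = p.
Proof.
move=> sz; apply/polyP=> i; rewrite !coef_revpoly leq_subr.
case: leqP => le; first by rewrite subKn.
by rewrite nth_default // (leq_trans sz).
Qed.

Lemma size_charpoly (T : finType) (M : matroid T) :
  (size (charpoly M) <= (rank M).+1)%N.
Proof.
apply: (leq_trans (size_sum _ _ _)); apply/bigmax_leqP=> F _.
by rewrite (leq_trans (size_scale_leq _ _)) // size_polyXn ltnS leq_subr.
Qed.

Lemma charpoly_kernel (T : finType) (M : matroid T) :
  loopless M -> (0 < rank M)%N ->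
  \sum_(F in flats M) revpoly (rk M F) (charpoly (restrict M F)) *
    charpoly (contract M F) = 0.
Proof.
move=> lM rM; set L := flats M; set mu := moebius L.
pose t H F K : {poly int} :=
  (mu set0 H * mu F K) *: 'X^(rk M H + (rank M - rk M K)).
transitivity (\sum_(F in L) \sum_(H in L | H \subset F)
                \sum_(K in L | F \subset K) t H F K).
  apply: eq_bigr => F fF; rewrite charpoly_restrict // charpoly_contract //.
  rewrite revpoly_sum mulr_suml; apply: eq_bigr => H /andP[fH sHF].
  rewrite mulr_sumr; apply: eq_bigr => K /andP[fK sFK].
  rewrite revpolyZ revpolyXn ?leq_subr // subKn ?rkS //.
  by rewrite -scalerAl -scalerAr scalerA -exprD.
transitivity (\sum_(H in L) \sum_(K in L)
                \sum_(F in L | (H \subset F)) t H F K).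
  rewrite (exchange_big_dep (mem L)) /=; last by move=> F H _ /andP[].
  apply: eq_bigr => H fH; rewrite [RHS]exchange_big /=.
  apply: eq_big => [F|F _]; first by rewrite fH.
  rewrite big_mkcondr; apply: eq_bigr => K _; case: ifP => // nFK.
  by rewrite /t /mu (@moebius_out _ L F K) ?nFK // mulr0 scale0r.
transitivity (\sum_(H in L) mu set0 H *: ('X^(rank M) : {poly int})).
  apply: eq_bigr => H fH; rewrite (bigD1 H) //= [X in _ + X]big1 ?addr0.
    rewrite -scaler_suml -mulr_sumr moebius_sumr // eqxx mulr1 subnKC //.
    by rewrite rkS // flats_sub.
  move=> K /andP[fK neKH]; rewrite -scaler_suml -mulr_sumr moebius_sumr //.
  by rewrite eq_sym (negPf neKH) mulr0 scale0r.
rewrite -scaler_suml.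
have -> : \sum_(H in L) mu set0 H = (set0 == ground M)%:R.
  rewrite -(moebius_suml _ (flat_ground M)) [RHS]big_mkcondr.
  by apply: eq_bigr => H fH; rewrite flats_sub.
case: eqP => [e|]; last by rewrite scale0r.
by move: rM; rewrite /rank -e rk0.
Qed.

Lemma rank_contract_lt (T : finType) (M : matroid T) (F : {set T}) :
  loopless M -> F \in flats M -> F != set0 ->
  (rank (contract M F) < rank M)%N.
Proof.
move=> lM fF nzF; have r0 : (0 < rk M F)%N.
  rewrite -(rk0 M) rk_lt_flat ?flat0 ?flats_sub //.
  by rewrite properEneq eq_sym nzF sub0set.
rewrite rank_contract ltn_subrL r0 /=; apply: leq_trans r0 _.
by rewrite rkS // flats_sub.
Qed.

Lemma kl_rec_fuel (T : finType) m n (M : matroid T) :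
  loopless M -> (rank M <= m)%N -> (rank M <= n)%N -> kl_rec m M = kl_rec n M.
Proof.
elim: m n M => [|m IH] [|n] M lM //=; rewrite ?leqn0.
- by move=> ->.
- by move=> _ ->.
move=> lem len; case: ifP => // _; apply/polyP=> i; rewrite !coef_poly.
case: ifP => // _; congr (nth _ (polyseq _) _); apply: eq_bigr => F /andP[fF nzF].
have ltr := rank_contract_lt lM fF nzF.
by rewrite (IH n) ?loopless_contract // -ltnS (leq_trans ltr).
Qed.

Definition kl_rest (T : finType) (M : matroid T) : {poly int} :=
  \sum_(F in flats M | F != set0)
    charpoly (restrict M F) * kl_poly (contract M F).

Lemma kl_polyE (T : finType) (M : matroid T) : loopless M ->
  kl_poly M = if rank M == 0%N then 1 else
              \poly_(i < uphalf (rank M)) (kl_rest M)`_(rank M - i).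
Proof.
move=> lM; rewrite /kl_poly; case def_r: (rank M) => [|r] //=.
rewrite def_r /=; apply/polyP=> i; rewrite !coef_poly.
case: ifP => // _; congr (nth _ (polyseq _) _); apply: eq_bigr => F /andP[fF nzF].
have ltr := rank_contract_lt lM fF nzF.
by congr (_ * _); apply: kl_rec_fuel; rewrite ?loopless_contract // -ltnS -def_r.
Qed.

Lemma ltn_uphalf i r : (i < uphalf r)%N = (i.*2 < r)%N.
Proof. by rewrite ltnNge leq_uphalf_double -ltnNge. Qed.

Lemma uphalf_le r : (uphalf r <= r)%N.
Proof. by rewrite leqNgt ltn_uphalf -leqNgt -addnn leq_addr. Qed.

Lemma kl_poly_coef (T : finType) (M : matroid T) i : loopless M ->
  (0 < rank M)%N ->
  (kl_poly M)`_i = if (i.*2 < rank M)%N then (kl_rest M)`_(rank M - i) else 0.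
Proof.
by move=> lM rM; rewrite kl_polyE // gtn_eqF // coef_poly ltn_uphalf.
Qed.

Lemma degree_bound r (p : {poly int}) : (0 < r)%N ->
  ((size p).-1.*2 < r)%N = (size p <= uphalf r)%N.
Proof.
move=> r0; case: (size p) => [|s] /=; first by rewrite double0 r0.
by rewrite ltn_uphalf.
Qed.

Theorem kl_poly_axioms (T : finType) : kl_axioms (@kl_poly T).
Proof.
move=> M; have [n] := ubnP (rank M); elim: n M => // n IH M ltMn lM.
have [r0|] := posnP (rank M).
  have one N : rank N = 0%N -> @kl_poly T N = 1 by rewrite /kl_poly => ->.
  split; rewrite ?r0 // one //.
  rewrite (bigD1 set0) ?flat0 //= big1 ?addr0 => [|F /andP[fF nzF]].
    rewrite charpoly_restrict0 // contract0 one // mul1r.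
    by apply/polyP=> -[|i]; rewrite coef_revpoly !coef1.
  by have := rank_contract_lt lM fF nzF; rewrite r0.
move=> r0; set r := rank M in r0 *.
have szP N : loopless N -> (size (@kl_poly T N) <= (rank N).+1)%N.
  move=> lN; rewrite kl_polyE //; case: eqP => _; first by rewrite size_poly1.
  by rewrite (leq_trans (size_poly _ _)) // leqW // uphalf_le.
have revR : revpoly r (kl_rest M) = - kl_rest M.
  rewrite /kl_rest revpoly_sum.
  transitivity (\sum_(F in flats M | F != set0)
      \sum_(G in flats M | F \subset G)
      revpoly (rk M F) (charpoly (restrict M F)) *
      charpoly (contract (restrict M G) F) * kl_poly (contract M G)).
    apply: eq_bigr => F /andP[fF nzF].
    have lF := loopless_contract fF.
    have ltF := rank_contract_lt lM fF nzF.
    have er : r = (rk M F + rank (contract M F))%N.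
      by rewrite rank_contract subnKC // rkS // flats_sub.
    rewrite er revpolyM ?szP //; last first.
      by rewrite -(rank_restrict M) size_charpoly.
    have [|_ _ ->] := IH (contract M F) _ lF.
      exact: leq_trans ltF _.
    rewrite sum_contract // mulr_sumr; apply: eq_bigr => G /andP[fG sFG].
    by rewrite restrict_contract // contract_contract // mulrA.
  rewrite (exchange_big_dep (mem (flats M))) /=; last by move=> F G _ /andP[].
  rewrite (bigD1 set0) ?flat0 //= big1 ?add0r; last first.
    by move=> F /andP[/andP[_ nzF]]; rewrite ?flat0 // subset0 (negPf nzF).
  rewrite -sumrN; apply: eq_bigr => G /andP[fG nzG].
  rewrite -mulr_suml -mulNr; congr (_ * _).
  have lG := loopless_restrict G lM.
  have rG : (0 < rank (restrict M G))%N.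
    rewrite rank_restrict -(rk0 M) rk_lt_flat ?flat0 ?flats_sub //.
    by rewrite properEneq eq_sym nzG sub0set.
  have := charpoly_kernel lG rG.
  rewrite (bigD1 set0) ?flat0 //= contract0 charpoly_restrict0 // rk0.
  have -> : revpoly 0 1 = 1.
    by apply/polyP=> -[|i]; rewrite coef_revpoly !coef1.
  rewrite mul1r => /eqP; rewrite addr_eq0 => /eqP ->; rewrite opprK.
  apply: eq_big => [F|F].
    by rewrite flats_restrict // fG; do ?case: (_ \in _); rewrite //= andbC.
  move=> /andP[/andP[fF _] /andP[_ sFG]].
  by rewrite restrict_restrict // restrictE (setIidPl sFG).
split=> [e|_|]; first by rewrite /kl_poly -/r e.
  by rewrite degree_bound // kl_polyE // gtn_eqF // size_poly.
rewrite (bigD1 set0) ?flat0 //= charpoly_restrict0 // contract0 mul1r -/(kl_rest M).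
have cR i : (if (i <= r)%N then (kl_rest M)`_(r - i) else 0) =
            - (kl_rest M)`_i.
  by rewrite -coef_revpoly revR coefN.
apply/polyP=> i; rewrite coefD coef_revpoly !kl_poly_coef // -/r.
have [leir|ltri] := leqP i r; last first.
  have := cR i; rewrite leqNgt ltri /= => /esym/eqP; rewrite oppr_eq0 => /eqP ->.
  by rewrite ltnNge -addnn (leq_trans (ltnW ltri)) ?leq_addr // addr0.
have := cR i; rewrite leir subKn // => e.
have e2 : ((r - i).*2 < r)%N = (r < i.*2)%N.
  rewrite doubleB ltn_subLR ?leq_double //.
  by rewrite -[X in (X < _)%N = _]addnn ltn_add2r.
rewrite e2; case: (ltngtP r i.*2) => [_|_|er]; rewrite ?add0r ?e ?addNr //.
have eri : (r - i = i)%N by rewrite er -addnn addnK.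
by rewrite eri in e; apply/esym/eqP; rewrite -Num.Theory.eqNr -e.
Qed.

Theorem kl_poly_unique (T : finType) (P : matroid T -> {poly int}) :
  kl_axioms P -> forall M, loopless M -> P M = kl_poly M.
Proof.
move=> axP M; have [n] := ubnP (rank M); elim: n M => // n IH M ltMn lM.
have [P0 Pd Pr] := axP M lM; have [Q0 Qd Qr] := kl_poly_axioms lM.
have [r0|r0] := posnP (rank M); first by rewrite P0 // Q0.
move: Pr Qr (Pd r0) (Qd r0); rewrite !degree_bound //.
rewrite (bigD1 set0) ?flat0 // [in X in _ -> X -> _](bigD1 set0) ?flat0 //=.
rewrite charpoly_restrict0 // contract0 !mul1r => Pr Qr szP szQ.
have {Pr Qr} /polyP e :
    revpoly (rank M) (P M) - P M = revpoly (rank M) (kl_poly M) - kl_poly M.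
  rewrite Pr Qr [LHS]addrC addKr [RHS]addrC addKr; apply: eq_bigr => F /andP[fF nzF].
  rewrite IH ?loopless_contract //.
  exact: leq_trans (rank_contract_lt lM fF nzF) _.
apply/polyP=> i; have [le|lt] := leqP (uphalf (rank M)) i.
  by rewrite !nth_default // (leq_trans _ le).
have := e i; rewrite !coefB !coef_revpoly.
have lei : (i <= rank M)%N by rewrite (leq_trans (ltnW lt)) // uphalf_le.
have le2 : (uphalf (rank M) <= rank M - i)%N.
  rewrite leqNgt ltn_uphalf -leqNgt doubleB leq_subRL ?leq_double //.
  by rewrite -[leqRHS]addnn leq_add2r ltnW // -ltn_uphalf.
have z (p : {poly int}) : (size p <= uphalf (rank M))%N ->
    p`_(rank M - i) = 0.
  by move=> sz; rewrite nth_default // (leq_trans sz).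
by rewrite lei !z // !sub0r => /oppr_inj.
Qed.

(* Main.v *)
(* The polynomial Z_M = \sum_F t^(rk F) P_(M^F) is palindromic of degree rk M,
   and together with the degree bound this determines P_M.  For the uniform
   matroid of rank d on m + d elements, binomial inversion turns palindromicity
   into the symmetry of a kernel proportional to
   (-1)^(k + i) / (m + max(k, i)); this gives the coefficients of P explicitly.
   Declaring a circuit-hyperplane to be a basis adds to Z_M
   Z_(1, d) - (1 + t) Z_(1, d - 1), where Z_(m, d) and P_(m, d) are those of the
   uniform matroid,
   so that
     P_M = P_(m, d) - lambda (P_(1, d) - P_(1, d - 1)).
   The coefficient of degree (d - 1) / 2 is compared with the bounds
   lambda (m + 1) <= C(m + d, d) and lambda (d + 1) <= C(m + d, d), which come
   from counting the (d - 1)-sets inside, and the (d + 1)-sets around, the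
   circuit-hyperplanes. *)
Require Import Defs.
From mathcomp Require Import all_boot all_order all_algebra.
From mathcomp Require Import ring lra zify.

Set Implicit Arguments.
Unset Strict Implicit.
Unset Printing Implicit Defensive.

Import Order.TTheory GRing.Theory Num.Theory.
Local Open Scope ring_scope.

(** * Z-polynomials *)

(** Expanding the characteristic polynomials, the coefficient of the term of [G] is the sum of the
    Moebius values from [F] to [G] over the flats [F] below [G], which vanishes unless [G] is the
    least flat. *)
Lemma sum_charpoly_contract (T : finType) (M : matroid T) :
  loopless M ->
  \sum_(F in flats M) charpoly (contract M F) = 'X^(rank M).
Proof.
move=> lM; set L := flats M.
under eq_bigr => F fF do rewrite charpoly_contract //.
rewrite (exchange_big_dep (mem L)) /=; last by move=> F G _ /andP[].
transitivity (\sum_(G in L) (set0 == G)%:R *: ('X^(rank M - rk M G) : {poly int})).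
  apply: eq_bigr => G fG; rewrite -scaler_suml; congr (_ *: _).
  rewrite -(moebius_sumr (flat0 lM) fG) big_mkcondr [RHS]big_mkcondr.
  apply: eq_bigr => F fF; rewrite fG sub0set /=.
  by case: ifP => // /negbT /moebius_out ->.
rewrite (bigD1 set0) ?flat0 //= eqxx scale1r rk0 subn0 big1 ?addr0 // => G.
by case/andP=> _ nzG; rewrite eq_sym (negPf nzG) scale0r.
Qed.

Definition zpoly (T : finType) (M : matroid T) : {poly int} :=
  \sum_(F in flats M) 'X^(rk M F) * kl_poly (contract M F).

(** The defining recursion, applied to each contraction, gives a double sum over flats [F] below
    [G]; for fixed [G] the characteristic polynomials add up to ['X^(rk M G)]. *)
Lemma zpolyE (T : finType) (M : matroid T) :
  loopless M ->
  \sum_(F in flats M)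
    revpoly (rank (contract M F)) (kl_poly (contract M F)) = zpoly M.
Proof.
move=> lM; transitivity (\sum_(F in flats M) \sum_(G in flats M | F \subset G)
    charpoly (contract (restrict M G) F) * kl_poly (contract M G)).
  apply: eq_bigr => F fF.
  have [_ _ ->] := kl_poly_axioms (loopless_contract fF).
  rewrite sum_contract //; apply: eq_bigr => G /andP[fG sFG].
  by rewrite restrict_contract // contract_contract.
rewrite (exchange_big_dep (mem (flats M))) /=; last by move=> F G _ /andP[].
apply: eq_bigr => G fG; rewrite -mulr_suml; congr (_ * _).
rewrite -(rank_restrict M) -sum_charpoly_contract ?loopless_restrict //.
by apply: eq_bigl => F; rewrite flats_restrict // fG.
Qed.

Lemma zpoly_palindromic (T : finType) (M : matroid T) j :
  loopless M -> (j <= rank M)%N -> (zpoly M)`_j = (zpoly M)`_(rank M - j).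
Proof.
move=> lM lej; rewrite -{1}zpolyE // !coef_sum; apply: eq_bigr => F fF.
rewrite coef_revpoly coefXnM rank_contract.
have leF : (rk M F <= rank M)%N by rewrite rkS ?flats_sub.
have -> : (rank M - j < rk M F)%N = ~~ (j <= rank M - rk M F)%N by lia.
by case: leqP => //= _; rewrite subnAC.
Qed.

(** * Uniform matroids *)

(** The numerator [m] normalises the constant coefficients to 1, see [unif_coef0]. *)
Definition unif_kernel (m k i : nat) : rat :=
  (-1) ^+ (k + i) * (m%:R / (m + maxn k i)%:R).

Definition unif_trans (m a i : nat) : rat :=
  \sum_(k < a.+1) 'C(a, k)%:R * unif_kernel m k i.

(* The coefficient of t^i in the Kazhdan-Lusztig polynomial of the uniform
   matroid of rank a + i on m + a + i elements; indexing by a = d - i makes the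
   palindromicity of the Z-polynomial a symmetry between a and the degree. *)
Definition unif_coef (m a i : nat) : rat :=
  'C(a + i + m, i)%:R * 'C(m + a, m)%:R * unif_trans m a i.

Lemma unif_kernelC m k i : unif_kernel m k i = unif_kernel m i k.
Proof. by rewrite /unif_kernel addnC maxnC. Qed.

(** Both sides are the same double binomial transform of a symmetric kernel. *)
Lemma unif_trans_sym m a b :
  \sum_(i < b.+1) 'C(b, i)%:R * unif_trans m a i =
  \sum_(i < a.+1) 'C(a, i)%:R * unif_trans m b i.
Proof.
under eq_bigr => i _ do rewrite mulr_sumr.
under [RHS]eq_bigr => i _ do rewrite mulr_sumr.
rewrite exchange_big; apply: eq_bigr => i _; apply: eq_bigr => k _.
by rewrite unif_kernelC; ring.
Qed.

Lemma alternating_binomial (R : comPzRingType) a :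
  (0 < a)%N -> \sum_(k < a.+1) 'C(a, k)%:R * (-1) ^+ k = 0 :> R.
Proof.
move=> a0; have := exprDn (1 : R) (-1) a.
rewrite subrr expr0n gtn_eqF //= => /esym e; rewrite -[RHS]e.
by apply: eq_bigr => k _; rewrite expr1n mul1r mulr_natl.
Qed.

(** For [k <= a <= i] the maximum in the kernel is always [i], which leaves an alternating sum of
    binomials. This yields the degree bound of [unif_poly]. *)
Lemma unif_trans_eq0 m a i : (0 < a <= i)%N -> unif_trans m a i = 0.
Proof.
case/andP=> a0 leai; rewrite /unif_trans.
transitivity ((-1) ^+ i * (m%:R / (m + i)%:R) *
              \sum_(k < a.+1) 'C(a, k)%:R * (-1) ^+ k : rat).
  rewrite mulr_sumr; apply: eq_bigr => k _; rewrite /unif_kernel exprD.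
  by have /maxn_idPr -> : (k <= i)%N; [have := ltn_ord k; lia | ring].
by rewrite alternating_binomial // mulr0.
Qed.

(** Up to sign, the [a]-th finite difference of 1 / x at [m]: by Pascal's rule the sum for [a.+1] at
    [m] is the difference of the sums for [a] at [m] and at [m.+1]. *)
Lemma sum_binomial_inv a m : (0 < m)%N ->
  \sum_(k < a.+1) 'C(a, k)%:R * ((-1) ^+ k / (m + k)%:R) =
  (m%:R * 'C(m + a, m)%:R)^-1 :> rat.
Proof.
elim: a m => [|a IH] m m0.
  by rewrite big_ord1 bin0 addn0 binn mulr1 mul1r expr0 mul1r.
rewrite big_ord_recl bin0.
have -> : \sum_(k < a.+1) 'C(a.+1, lift ord0 k)%:R *
      ((-1) ^+ lift ord0 k / (m + lift ord0 k)%:R) =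
    \sum_(k < a.+1) 'C(a, k.+1)%:R * ((-1) ^+ k.+1 / (m + k.+1)%:R) +
    \sum_(k < a.+1) 'C(a, k)%:R * ((-1) ^+ k.+1 / (m + k.+1)%:R) :> rat.
  rewrite -big_split /=; apply: eq_bigr => k _.
  by rewrite /bump leq0n add1n binS natrD mulrDl.
rewrite addrA [X in _ + X + _]big_ord_recr /= bin_small // mul0r addr0.
transitivity (\sum_(k < a.+1) 'C(a, k)%:R * ((-1) ^+ k / (m + k)%:R)
  - \sum_(k < a.+1) 'C(a, k)%:R * ((-1) ^+ k / (m.+1 + k)%:R) : rat).
  rewrite -sumrN; congr (_ + _).
    by rewrite [RHS]big_ord_recl bin0.
  by apply: eq_bigr => k _; rewrite addnS addSn exprS; ring.
rewrite !IH // addnS addSn.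
have e1 : m.+1%:R * 'C((m + a).+1, m.+1)%:R = (m + a).+1%:R * 'C(m + a, m)%:R :> rat.
  by rewrite -!natrM mul_bin_diag.
have e2 : a.+1%:R * 'C((m + a).+1, m)%:R = (m + a).+1%:R * 'C(m + a, m)%:R :> rat.
  by rewrite -!natrM [in RHS](mul_bin_down (m + a).+1) -addnS addKn.
have c1 : 'C((m + a).+1, m)%:R != 0 :> rat by rewrite pnatr_eq0 -lt0n bin_gt0; lia.
have c0 : 'C(m + a, m)%:R != 0 :> rat by rewrite pnatr_eq0 -lt0n bin_gt0; lia.
have n0 k : k.+1%:R != 0 :> rat by rewrite pnatr_eq0.
have mz : m%:R != 0 :> rat by rewrite pnatr_eq0 -lt0n.
rewrite e1.
have -> : 'C((m + a).+1, m)%:R = (m + a).+1%:R * 'C(m + a, m)%:R / a.+1%:R :> rat.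
  by rewrite -e2 mulrC mulKf.
have -> : (m + a).+1%:R = m%:R + a.+1%:R :> rat by rewrite -addnS natrD.
have s0 : m%:R + a.+1%:R != 0 :> rat by rewrite -natrD addnS n0.
have := n0 a; move: s0; move: (a.+1%:R) => A s0 A0.
by field; rewrite A0 c0 mz s0.
Qed.

Lemma unif_coef0 m a : (0 < m)%N -> unif_coef m a 0 = 1.
Proof.
move=> m0; rewrite /unif_coef bin0 mul1r /unif_trans.
transitivity ('C(m + a, m)%:R * (m%:R *
  \sum_(k < a.+1) 'C(a, k)%:R * ((-1) ^+ k / (m + k)%:R)) : rat).
  congr (_ * _); rewrite mulr_sumr; apply: eq_bigr => k _.
  by rewrite /unif_kernel maxn0 addn0; ring.
rewrite sum_binomial_inv //.
have c0 : 'C(m + a, m)%:R != 0 :> rat by rewrite pnatr_eq0 -lt0n bin_gt0; lia.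
have mz : m%:R != 0 :> rat by rewrite pnatr_eq0 -lt0n.
by field; rewrite c0.
Qed.

(** The top coefficient in rank [e.*2.+1]: only the term [k = e.+1] has a maximum other than [e],
    and the others form an alternating sum short of its last term. *)
Lemma unif_trans_top m e : (0 < m)%N ->
  unif_trans m e.+1 e = m%:R / ((m + e)%:R * (m + e).+1%:R).
Proof.
move=> m0; rewrite /unif_trans big_ord_recr /=.
transitivity ((-1) ^+ e * (m%:R / (m + e)%:R) *
    (\sum_(k < e.+1) 'C(e.+1, k)%:R * (-1) ^+ k)
    - m%:R / (m + e).+1%:R : rat).
  rewrite mulr_sumr; congr (_ + _).
    apply: eq_bigr => k _; rewrite /unif_kernel exprD.
    by have /maxn_idPr -> : (k <= e)%N; [have := ltn_ord k; lia | ring].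
  rewrite binn mul1r /unif_kernel (maxn_idPl (leqnSn e)) addSn exprS exprD -expr2 sqrr_sign.
  by rewrite mulr1 mulN1r addnS.
have := @alternating_binomial rat e.+1 isT; rewrite big_ord_recr /= binn mul1r.
move/eqP; rewrite addr_eq0 => /eqP ->.
rewrite exprS mulN1r opprK mulrC mulrA -expr2 sqrr_sign mul1r.
have -> : (m + e).+1%:R = (m + e)%:R + 1 :> rat by rewrite natr1.
have z : (m + e)%:R != 0 :> rat by rewrite pnatr_eq0; lia.
have z1 : (m + e)%:R + 1 != 0 :> rat by rewrite natr1 pnatr_eq0.
move: z z1; move: ((m + e)%:R : rat) => x z z1.
by field; rewrite z z1.
Qed.

(** The analogue for rank [e.*2.+2], where the last two terms deviate. *)
Lemma unif_trans_subtop m e : (0 < m)%N ->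
  unif_trans m e.+2 e = m%:R * (e * (m + e + 2) + 2)%:R /
    ((m + e)%:R * (m + e).+1%:R * (m + e).+2%:R).
Proof.
move=> m0; rewrite /unif_trans big_ord_recr big_ord_recr /=.
transitivity ((-1) ^+ e * (m%:R / (m + e)%:R) *
    (\sum_(k < e.+1) 'C(e.+2, k)%:R * (-1) ^+ k)
    - e.+2%:R * (m%:R / (m + e).+1%:R) + m%:R / (m + e).+2%:R : rat).
  rewrite mulr_sumr; congr (_ + _ + _).
  - apply: eq_bigr => k _; rewrite /unif_kernel exprD.
    by have /maxn_idPr -> : (k <= e)%N; [have := ltn_ord k; lia | ring].
  - rewrite binSn /unif_kernel (maxn_idPl (leqnSn e)) addSn exprS exprD -expr2.
    by rewrite sqrr_sign mulr1 mulN1r mulrN addnS.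
  - rewrite binn mul1r /unif_kernel (maxn_idPl (leqW (leqnSn e))).
    by rewrite !addSn !exprS exprD -expr2 sqrr_sign !mulN1r opprK mul1r !addnS.
have := @alternating_binomial rat e.+2 isT; rewrite big_ord_recr big_ord_recr /=.
rewrite binn mul1r binSn -addrA => /eqP; rewrite addr_eq0 => /eqP ->.
have -> : (-1) ^+ e * (m%:R / (m + e)%:R) *
   - (e.+2%:R * (-1) ^+ e.+1 + (-1) ^+ e.+2) =
   ((-1) ^+ e) ^+ 2 * (m%:R / (m + e)%:R * (e.+2%:R - 1)) :> rat.
  by rewrite !exprS; ring.
rewrite sqrr_sign mul1r.
have -> : (m + e).+2%:R = (m + e)%:R + 1 + 1 :> rat by rewrite !natr1.
have -> : (m + e).+1%:R = (m + e)%:R + 1 :> rat by rewrite natr1.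
have -> : e.+2%:R = e%:R + 1 + 1 :> rat by rewrite !natr1.
have z : (m + e)%:R != 0 :> rat by rewrite pnatr_eq0; lia.
have z1 : (m + e)%:R + 1 != 0 :> rat by rewrite natr1 pnatr_eq0.
have z2 : (m + e)%:R + 1 + 1 != 0 :> rat by rewrite !natr1 pnatr_eq0.
rewrite !(natrD, natrM) in z z1 z2 *.
move: z z1 z2; move: (m%:R : rat) (e%:R : rat) => x y z z1 z2.
by field; rewrite z z1 z2.
Qed.

(** Rank 0 is set apart because an empty [\poly] is 0. For [i < d] the index [d - i] is positive, so
    [unif_trans_eq0] kills the coefficients of degree at least d / 2. *)
Definition unif_poly (m d : nat) : {poly rat} :=
  if d is 0%N then 1 else \poly_(i < d) unif_coef m (d - i) i.

Lemma coef_unif_poly m d i :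
  (i < d)%N -> (unif_poly m d)`_i = unif_coef m (d - i) i.
Proof. by case: d => // d lid; rewrite coef_poly lid. Qed.

Lemma size_unif_poly m d :
  (0 < d)%N -> (size (unif_poly m d) <= uphalf d)%N.
Proof.
move=> d0; apply/leq_sizeP => i; rewrite leq_uphalf_double => ledi.
case: d d0 ledi => // d _ ledi; rewrite coef_poly; case: ifP => // lid.
by rewrite /unif_coef unif_trans_eq0 ?mulr0 // subn_gt0 lid /=; lia.
Qed.

Lemma unif_poly1 m : (0 < m)%N -> unif_poly m 1 = 1.
Proof.
move=> m0; rewrite (size1_polyC (size_unif_poly m (isT : 0 < 1)%N)).
by rewrite coef_unif_poly // unif_coef0.
Qed.

(** Grouped by rank: for [k < d] the flats of rank [k] are the [k]-sets, with uniform contractions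
    of rank [d - k]; the ground set contributes ['X^d]. *)
Definition unif_zpoly (m d : nat) : {poly rat} :=
  \sum_(k < d) 'C(m + d, k)%:R *: ('X^k * unif_poly m (d - k)) + 'X^d.

(** Both products are the multinomial coefficient n! / ((b - i)! i! (n - b)!). *)
Lemma bin_mul_bin n b i : (i <= b <= n)%N ->
  ('C(n, b - i) * 'C(n - b + i, i) = 'C(n, b) * 'C(b, i))%N.
Proof.
case/andP=> leib lebn; have f0 := fact_gt0.
have e1 := @bin_fact n (b - i) ltac:(lia).
have e2 := @bin_fact (n - b + i) i ltac:(lia).
have e3 := bin_fact lebn; have e4 := bin_fact leib.
have e5 : (n - (b - i) = n - b + i)%N by lia.
rewrite addnK in e2; rewrite e5 in e1; rewrite -e2 in e1; rewrite -e4 in e3.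
have : ('C(n, b - i) * 'C(n - b + i, i) * ((b - i)`! * i`! * (n - b)`!) =
  'C(n, b) * 'C(b, i) * ((b - i)`! * i`! * (n - b)`!))%N.
  by move: e1; rewrite -e3; nia.
by move/eqP; rewrite eqn_pmul2r ?muln_gt0 ?f0 // => /eqP.
Qed.

(** Flats of rank [j - i] contribute their coefficient of degree [i], whose first index
    [d - (j - i) - i = d - j] does not depend on [i]; [bin_mul_bin] takes the binomials out of the
    sum. *)
Lemma coef_unif_zpoly m d j : (j < d)%N ->
  (unif_zpoly m d)`_j = 'C(m + d, j)%:R * 'C(m + (d - j), m)%:R *
  \sum_(i < j.+1) 'C(j, i)%:R * unif_trans m (d - j) i.
Proof.
move=> ltjd; rewrite coefD coefXn ltn_eqF // addr0 coef_sum.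
pose c k := ('C(m + d, k)%:R *: ('X^k * unif_poly m (d - k)))`_j.
transitivity (\sum_(k < j.+1) c k).
  rewrite [RHS](big_ord_widen d c) // [RHS]big_mkcond; apply: eq_bigr => k _.
  by case: ifPn => //; rewrite ltnS -ltnNge => ltjk; rewrite coefZ coefXnM ltjk mulr0.
rewrite (reindex_inj rev_ord_inj) /= mulr_sumr; apply: eq_bigr => i _.
have leij : (i <= j)%N by rewrite -ltnS.
rewrite /c subSS coefZ coefXnM ltnNge leq_subr /= subKn //.
rewrite coef_unif_poly; last by lia.
have -> : (d - (j - i) - i = d - j)%N by lia.
have := @bin_mul_bin (m + d) j i ltac:(lia).
have -> : (m + d - j + i = d - j + i + m)%N by lia.
by rewrite /unif_coef => /(congr1 (fun k => k%:R : rat)); rewrite !natrM => e; ring: e.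
Qed.

Lemma unif_zpoly_palindromic m d j : (0 < m)%N -> (j <= d)%N ->
  (unif_zpoly m d)`_j = (unif_zpoly m d)`_(d - j).
Proof.
move=> m0 lejd; have [d0|d0] := posnP d; first by move: lejd; rewrite d0; case: j.
(* Degree [d] lies outside [coef_unif_zpoly]; by the degree bound only the summand ['X^d] reaches
   it. *)
have ends : (unif_zpoly m d)`_0 = (unif_zpoly m d)`_d.
  rewrite coef_unif_zpoly // big_ord1 !bin0 subn0 !mul1r.
  have := unif_coef0 d m0; rewrite /unif_coef bin0 mul1r => ->.
  rewrite coefD coefXn eqxx coef_sum big1 ?add0r //.
  move=> k _; rewrite coefZ coefXnM ltnNge ltnW //= nth_default ?mulr0 //.
  by rewrite (leq_trans (size_unif_poly _ _)) ?subn_gt0 // uphalf_le.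
have [->|j0] := posnP j; first by rewrite subn0.
have [->|ljd] := eqVneq j d; first by rewrite subnn ends.
have ltjd : (j < d)%N by rewrite ltn_neqAle ljd.
rewrite !coef_unif_zpoly ?subKn //; last by lia.
(* Both prefactors equal (m + d)! / (m! j! (d - j)!). *)
rewrite unif_trans_sym; congr (_ * _); rewrite -!natrM; congr _%:R.
have := @bin_fact (m + d) j ltac:(lia).
have := @bin_fact (m + d) (d - j) ltac:(lia).
have := @bin_fact (m + (d - j)) m ltac:(lia).
have := @bin_fact (m + j) m ltac:(lia).
rewrite !addKn => e1 e2 e3 e4.
have e5 : (m + d - j = m + (d - j))%N by lia.
have e6 : (m + d - (d - j) = m + j)%N by lia.
rewrite e5 -e2 in e4; rewrite e6 -e1 in e3.
have : ('C(m + d, j) * 'C(m + (d - j), m) * (m`! * j`! * (d - j)`!) =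
  'C(m + d, d - j) * 'C(m + j, m) * (m`! * j`! * (d - j)`!))%N.
  by transitivity (m + d)`!; [rewrite -e4 | rewrite -e3]; ring.
by move/eqP; rewrite eqn_pmul2r ?muln_gt0 ?fact_gt0 // => /eqP.
Qed.

Lemma size_unif_zpoly m d : (size (unif_zpoly m d) <= d.+1)%N.
Proof.
rewrite (leq_trans (size_polyD _ _)) // geq_max size_polyXn leqnn andbT.
apply: (leq_trans (size_sum _ _ _)); apply/bigmax_leqP => k _.
rewrite (leq_trans (size_scale_leq _ _)) // mulrC.
have := ltn_ord k; have [->|nz] := eqVneq (unif_poly m (d - k)) 0.
  by rewrite mul0r size_poly0.
rewrite size_mulXn // => ltkd; have := @size_unif_poly m (d - k).
by have := uphalf_le (d - k); lia.
Qed.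

(* What relaxing a circuit-hyperplane in rank d + 1 adds to the Z-polynomial:
   relaxing that of the sum of a coloop and the uniform matroid of rank d on
   d + 1 elements gives the uniform matroid of rank d + 1 on d + 2 elements. *)
Definition relax_zpoly (d : nat) : {poly rat} :=
  unif_zpoly 1 d.+1 - (1 + 'X) * unif_zpoly 1 d.

Lemma relax_zpoly_palindromic d j : (j <= d.+1)%N ->
  (relax_zpoly d)`_j = (relax_zpoly d)`_(d.+1 - j).
Proof.
move=> lejd; rewrite !coefB unif_zpoly_palindromic //; congr (_ - _).
rewrite mulrDl mul1r !(coefD (unif_zpoly 1 d)) !coefXM.
have top : (unif_zpoly 1 d)`_d.+1 = 0 by rewrite nth_default ?size_unif_zpoly.
have bot : (unif_zpoly 1 d)`_0 = (unif_zpoly 1 d)`_d.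
  by rewrite unif_zpoly_palindromic // subn0.
case: j lejd => [|j] lejd; first by rewrite subn0 /= top bot addr0 add0r.
rewrite subSS /= addrC [in LHS]unif_zpoly_palindromic //.
have [->|nejd] := eqVneq j d; first by rewrite subnn /= top.
have ltjd : (j < d)%N by rewrite ltn_neqAle nejd.
rewrite subn_eq0 leqNgt ltjd /=; congr (_ + _).
by rewrite unif_zpoly_palindromic // subnS.
Qed.

(** The change sorted by rank: for [k < d] the ['C(d.+1, k)] subsets of the relaxed
    circuit-hyperplane get a new contraction; the last term counts hyperplanes, one lost and its
    [d.+1] subsets of size [d] gained. *)
Lemma relax_zpolyE d : relax_zpoly d =
  \sum_(k < d.+1) 'C(d.+1, k)%:R *:
    ('X^k * (unif_poly 1 (d.+1 - k) - unif_poly 1 (d - k))) + d%:R *: 'X^d.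
Proof.
pose u := unif_poly 1.
have e1 : unif_zpoly 1 d.+1 = 'X^(d.+1) +
    \sum_(k < d.+1) 'C(d.+1, k)%:R *: ('X^k * u (d.+1 - k)%N) +
    'X * \sum_(k < d) 'C(d.+1, k)%:R *: ('X^k * u (d - k)%N).
  rewrite /unif_zpoly addrC -addrA; congr (_ + _).
  rewrite big_ord_recl [in RHS]big_ord_recl !bin0 -addrA; congr (_ + _).
  rewrite mulr_sumr -big_split; apply: eq_bigr => k _.
  rewrite /= /bump leq0n add1n add1n binS natrD scalerDl subSS; congr (_ + _).
  by rewrite -scalerAr mulrA exprS.
have e2 : \sum_(k < d.+1) 'C(d.+1, k)%:R *: ('X^k * u (d - k)%N) =
    \sum_(k < d) 'C(d.+1, k)%:R *: ('X^k * u (d - k)%N) + d.+1%:R *: 'X^d.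
  by rewrite big_ord_recr subnn /= mulr1 binSn.
under [in RHS]eq_bigr => k _ do rewrite mulrBr scalerBr.
rewrite sumrB e2 /relax_zpoly e1 /unif_zpoly add1n -/u.
set S := \sum_(k < d) _; set S1 := \sum_(k < d.+1) _.
by rewrite -natr1 scalerDl scale1r exprS; ring.
Qed.

(** * Sparse paving matroids *)

(* Sparse paving matroids differ from uniform ones only in the rank of sets of
   size [rank M]; the circuit-hyperplanes are the [nonbases] below. *)
Definition uniform_off_rank (T : finType) (M : matroid T) : Prop :=
  forall A : {set T}, A \subset ground M ->
  ((#|A| < rank M)%N -> rk M A = #|A|) /\ ((rank M < #|A|)%N -> rk M A = rank M).

Lemma paving_indep (T : finType) (M : matroid T) (A : {set T}) :
  paving M -> A \subset ground M -> (#|A| < rank M)%N -> rk M A = #|A|.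
Proof.
move=> /forallP pM sA ltA; apply/eqP; rewrite eqn_leq rk_card leqNgt.
apply/negP => depA; have [|C minC sCA] := @minset_exists _ (dependent M) A.
  by rewrite /dependent sA.
have := pM C; rewrite /circuit minC /= leqNgt => /negP[].
by rewrite (leq_ltn_trans (subset_leq_card sCA)).
Qed.

Lemma dualE (T : finType) (M : matroid T) (A : {set T}) :
  rk (dual M) A = (#|A :&: ground M| + rk M (ground M :\: A) - rank M)%N.
Proof. by rewrite /rk /= ffunE. Qed.

Lemma rank_dual (T : finType) (M : matroid T) :
  rank (dual M) = (#|ground M| - rank M)%N.
Proof. by rewrite /rank dualE /= setIid setDv rk0 addn0. Qed.

(** A set of more than [rank M] elements has a complement too small to be dependent in the dual,
    hence it is spanning. *)
Lemma sparse_paving_uniform_off_rank (T : finType) (M : matroid T) :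
  sparse_paving M -> uniform_off_rank M.
Proof.
case/andP=> pM pdM A sA; split; first exact: paving_indep.
move=> ltA; have cD : #|ground M :\: A| = (#|ground M| - #|A|)%N.
  by rewrite cardsD (setIidPr sA).
have leA := subset_leq_card sA.
have : rk (dual M) (ground M :\: A) = #|ground M :\: A|.
  by apply: paving_indep => //=; rewrite ?subsetDl // rank_dual cD; lia.
have sAr := rkS M sA; rewrite -/(rank M) in sAr.
have := dual_le M (ground M :\: A).
rewrite dualE setDDr setDv set0U (setIidPr sA) (setIidPl _) ?subsetDl // cD.
lia.
Qed.

Definition nonbases (T : finType) (M : matroid T) : {set {set T}} :=
  [set A : {set T} | [&& A \subset ground M, #|A| == rank M & (rk M A < rank M)%N]].

Definition nonbases_over (T : finType) (M : matroid T) (X : {set T}) : nat :=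
  #|[set H in nonbases M | X \subset H]|.

Lemma nonbasesP (T : finType) (M : matroid T) (A : {set T}) :
  reflect [/\ A \subset ground M, #|A| = rank M & (rk M A < rank M)%N]
    (A \in nonbases M).
Proof.
by rewrite inE; apply: (iffP and3P) => -[sA /eqP cA rA]; split=> //; apply/eqP.
Qed.

Section UniformOffRank.

Variables (T : finType) (M : matroid T).
Hypothesis uM : uniform_off_rank M.
Implicit Types A F H X : {set T}.

Let E := ground M.
Let d := rank M.

Lemma rk_nonbasis H : H \in nonbases M -> (rk M H).+1 = d.
Proof.
case/nonbasesP=> sH cH rH; apply/eqP; rewrite eqn_leq rH /=.
have [x xH] : exists x, x \in H by apply/card_gt0P; rewrite cH; lia.
have cHx : #|H :\ x|.+1 = d by rewrite /d -cH (cardsD1 x H) xH.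
have sHx : H :\ x \subset E by rewrite (subset_trans (subsetDl _ _)).
have := rkS M (subsetDl H [set x]); have [u1 _] := uM sHx.
by rewrite u1 -/d; lia.
Qed.

Lemma nonbasis_flat H : H \in nonbases M -> H \in flats M.
Proof.
move=> bH; have /nonbasesP[sH cH rH] := bH; apply/flatP; split=> // x xE xH.
have sxH : x |: H \subset E by rewrite subUset sub1set xE.
by have [_ ->] := uM sxH; rewrite // cardsU1 xH cH.
Qed.

Lemma circuit_hyperplanesE : circuit_hyperplanes M = nonbases M.
Proof.
apply/setP=> A; rewrite inE; apply/idP/idP => [/andP[/minsetp/andP[sA dA]]|bA].
  case/andP=> _ /eqP rA; have [u1 u2] := uM sA; apply/nonbasesP; split=> //.
    by case: (ltngtP #|A| (rank M)) => [/u1|/u2|] //; lia.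
  by rewrite -rA.
have /nonbasesP[sA cA rA] := bA; apply/andP; split; last first.
  rewrite /hyperplane (rk_nonbasis bA) eqxx andbT.
  by have := nonbasis_flat bA; rewrite inE.
apply/minsetP; split; first by rewrite /dependent sA cA.
move=> B /andP[sB dB] sBA; apply/eqP; rewrite eqEcard sBA leqNgt cA.
by apply/negP => /(proj1 (uM sB)) rB; rewrite rB ltnn in dB.
Qed.

Lemma small_flat F : F \subset E -> (#|F|.+1 < d)%N -> F \in flats M.
Proof.
move=> sF cF; apply/flatP; split=> // x xE xF.
have sxF : x |: F \subset E by rewrite subUset sub1set xE.
have cxF : #|x |: F| = #|F|.+1 by rewrite cardsU1 xF.
have [u1 _] := uM sxF; have [u2 _] := uM sF.
by rewrite u1 ?u2 ?cxF //; lia.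
Qed.

Lemma rk_cases A : A \subset E ->
  [\/ (#|A| < d)%N /\ rk M A = #|A|, A \in nonbases M | rk M A = d].
Proof.
move=> sA; have [u1 u2] := uM sA; case: (ltngtP #|A| d) => cA.
- by constructor 1; rewrite u1.
- by constructor 3; rewrite u2.
- have [bA|bA] := boolP (A \in nonbases M); first by constructor 2.
  constructor 3; apply/eqP; rewrite eqn_leq (rkS M sA) leqNgt.
  by apply: contra bA => rA; apply/nonbasesP.
Qed.

Lemma small_flatE F k : (k.+1 < d)%N ->
  (F \in flats M) && (rk M F == k) = (F \subset E) && (#|F| == k).
Proof.
move=> ltk; apply/andP/andP => [[fF /eqP rF]|[sF /eqP cF]]; last first.
  have [u1 _] := uM sF; rewrite small_flat ?cF // u1 cF ?eqxx //.
  exact: ltnW.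
have sF := flats_sub fF; split=> //.
case: (rk_cases sF) => [[_ <-]|/rk_nonbasis|]; first by rewrite rF.
  all: by rewrite rF; lia.
Qed.

(** A [(d - 1)]-set inside a nonbasis has the rank of that nonbasis, so it is not a flat. *)
Lemma hyperplane_cases F : (0 < d)%N -> F \in flats M -> (rk M F).+1 = d ->
  (#|F|.+1 = d /\ nonbases_over M F = 0%N) \/ F \in nonbases M.
Proof.
move=> d0 fF rF; have sF := flats_sub fF.
case: (rk_cases sF) => [[cF cr]|bF|]; [left|by right|lia].
rewrite -cr; split=> //; apply/eqP; rewrite cards_eq0; apply/eqP/setP=> H.
rewrite !inE; apply/negP => /andP[/and3P[sH /eqP cH rH] sFH].
have pF : F \proper H by rewrite properEcard sFH cH; lia.
by have := rk_lt_flat fF pF sH; lia.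
Qed.

(** If [H1] and [H2] differ, their union has more than [d] elements, hence rank [d], and their
    intersection has rank at least [d - 1]; this contradicts submodularity, as both have rank
    [d - 1]. *)
Lemma nonbases_cap_small X H1 H2 : H1 \in nonbases M -> H2 \in nonbases M ->
  X \subset H1 -> X \subset H2 -> #|X|.+1 = d -> H1 = H2.
Proof.
move=> b1 b2 s1 s2 cX; have /nonbasesP[sH1 c1 _] := b1.
have /nonbasesP[sH2 c2 _] := b2.
have r1 := rk_nonbasis b1; have r2 := rk_nonbasis b2.
apply/eqP; rewrite eqEcard c1 c2 leqnn andbT; apply: contraT => nH.
have rI : (#|X| <= rk M (H1 :&: H2))%N.
  have [u1 _] := uM (subset_trans s1 sH1).
  by rewrite -u1 ?rkS ?subsetI ?s1 //; lia.
have sU : H1 :|: H2 \subset E by rewrite subUset sH1.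
have rU : rk M (H1 :|: H2) = d.
  apply: (proj2 (uM sU)); rewrite -c2 proper_card // properE subsetUr /=.
  by rewrite subUset subxx andbT.
by have := rk_submod M H1 H2; lia.
Qed.

Lemma nonbases_over_le1 X : #|X|.+1 = d -> (nonbases_over M X <= 1)%N.
Proof.
move=> cX; rewrite leqNgt; apply/negP => /card_gt1P[H1 [H2 []]].
rewrite !inE => /andP[b1 s1] /andP[b2 s2] /eqP[].
by apply: (nonbases_cap_small (X := X)); rewrite ?inE.
Qed.

Lemma sum_nonbases_over k :
  (\sum_(X in [set X : {set T} | (X \subset E) && (#|X| == k)]) nonbases_over M X =
  #|nonbases M| * 'C(d, k))%N.
Proof.
transitivity (\sum_(X in [set X : {set T} | (X \subset E) && (#|X| == k)])
    \sum_(H in nonbases M | X \subset H) 1)%N.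
  by apply: eq_bigr => X _; rewrite sum1dep_card.
rewrite (exchange_big_dep (mem (nonbases M))) /=; last by move=> X H _ /andP[].
rewrite -sum_nat_const; apply: eq_bigr => H bH.
have /nonbasesP[sH cH _] := bH; rewrite sum1dep_card /d -cH -cards_draws.
apply: eq_card => X; rewrite [LHS]in_set [RHS]in_set.
rewrite [X \in _]in_set bH; case sXH: (X \subset H) => /=.
  by rewrite (subset_trans sXH sH) andbT.
by rewrite !andbF.
Qed.

(** The hyperplanes are the nonbases and the [(d - 1)]-sets in no nonbasis. Each nonbasis excludes
    [d] such sets, none of them twice by [nonbases_over_le1]. The additive form avoids truncated
    subtraction. *)
Lemma card_hyperplanes : (0 < d)%N ->
  (#|[set F in flats M | rk M F == d.-1]| + #|nonbases M| * d =
   'C(#|E|, d.-1) + #|nonbases M|)%N.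
Proof.
move=> d0; set D := [set X : {set T} | (X \subset E) && (#|X| == d.-1)].
have -> : [set F in flats M | rk M F == d.-1] =
    [set X in D | nonbases_over M X == 0%N] :|: nonbases M.
  apply/setP=> F; rewrite in_setU [LHS]in_set [in RHS]in_set [F \in D]in_set.
  apply/andP/orP => [[fF /eqP rF]|[/andP[/andP[sF /eqP cF]]|]].
  - case: (hyperplane_cases d0 fF); [lia|case=> cF ->|by right].
    by left; rewrite (flats_sub fF) -cF !eqxx.
  - rewrite cards_eq0 => /eqP/setP z; have rF : rk M F = d.-1.
      by have [u1 _] := uM sF; rewrite u1 -/d; lia.
    split; last exact/eqP.
    apply/flatP; split=> // x xE xF; rewrite rF.
    have sxF : x |: F \subset E by rewrite subUset sub1set xE.
    have cxF : #|x |: F| = d by rewrite cardsU1 xF cF; lia.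
    case: (rk_cases sxF) => [[]|bxF|->]; [by rewrite cxF ltnn| |by lia].
    by have := z (x |: F); rewrite !in_set0 in_set bxF subsetUr.
  - by move=> bF; rewrite nonbasis_flat //; have := rk_nonbasis bF; lia.
rewrite cardsU disjoint_setI0 ?cards0 ?subn0; last first.
  apply/pred0P=> F /=; rewrite !in_set; apply/negP => /andP[/andP[/andP[_ /eqP]]].
  by move=> cF _ /and3P[_ /eqP]; rewrite -/d; lia.
rewrite addnAC; congr (_ + _)%N.
have := sum_nonbases_over d.-1; rewrite -/D.
have -> : 'C(d, d.-1) = d by rewrite -[in LHS](prednK d0) binSn prednK.
move<-; rewrite -cards_draws -/D -sum1_card -[RHS]sum1_card.
rewrite [X in (X + _)%N](eq_bigl (fun X => (X \in D) && (nonbases_over M X == 0%N)));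
  last by move=> X; rewrite in_set.
rewrite big_mkcondr -big_split /=; apply: eq_bigr => X; rewrite in_set.
case/andP=> sX /eqP cX; have := @nonbases_over_le1 X.
by case: (nonbases_over M X) => [|[|n]] //; rewrite cX; lia.
Qed.

Lemma nonbases_bound : (#|nonbases M| * d <= 'C(#|E|, d.-1))%N.
Proof.
have [->|d0] := posnP d; first by rewrite muln0.
have := card_hyperplanes d0.
have /subset_leq_card : nonbases M \subset [set F in flats M | rk M F == d.-1].
  apply/subsetP=> H bH; rewrite in_set nonbasis_flat //=.
  by have := rk_nonbasis bH; lia.
lia.
Qed.

(** Pairs of a nonbasis [H] and an element [x] outside it inject into the [d.+1]-sets through
    [x |: H]. *)
Lemma nonbases_bound_dual :
  (#|nonbases M| * (#|E| - d) <= 'C(#|E|, d.+1))%N.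
Proof.
set P := [set p : {set T} * T | (p.1 \in nonbases M) && (p.2 \in E :\: p.1)].
have -> : (#|nonbases M| * (#|E| - d) = #|P|)%N.
  transitivity (\sum_(H in nonbases M) \sum_(x in E :\: H) 1)%N.
    rewrite -sum_nat_const; apply: eq_bigr => H /nonbasesP[sH cH _].
    by rewrite sum1_card cardsD (setIidPr sH) cH.
  by rewrite pair_big_dep /= -[RHS]sum1_card; apply: eq_bigl => p; rewrite [RHS]in_set.
rewrite -cards_draws -(card_in_imset (f := fun p => p.2 |: p.1) (D := P)).
  apply: subset_leq_card; apply/subsetP=> _ /imsetP[[H x] pP ->] /=.
  move: pP; rewrite in_set /= in_setD => /andP[/nonbasesP[sH cH _] /andP[xH xE]].
  by rewrite in_set subUset sub1set xE sH cardsU1 xH cH /=.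
move=> [H x] [K y] /=; rewrite !in_set /= => /andP[bH /andP[xH xE]].
case/andP=> bK /andP[yK yE] e.
have {}bH : H \in nonbases M by rewrite in_set.
have {}bK : K \in nonbases M by rewrite in_set.
have /nonbasesP[sH cH _] := bH; have /nonbasesP[sK cK _] := bK.
(* If [H] and [K] differ, an element of [K] outside [H] must be [x], so [K :\ x] is a [(d - 1)]-set
   inside both. *)
have eHK : H = K.
  apply/eqP/contraT => nHK; have [z zH zK] : exists2 z, z \in K & z \notin H.
    apply/subsetPn; apply: contra nHK => sKH.
    by rewrite eq_sym eqEcard sKH cH cK leqnn.
  have sKx : K :\ x \subset H.
    apply/subsetP=> t; rewrite in_setD1 => /andP[tx tK].
    by have := setU1r y tK; rewrite -e in_setU1 (negPf tx).
  have xK : x \in K.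
    by have := setU1r y zH; rewrite -e in_setU1 (negPf zK) orbF => /eqP <-.
  rewrite (nonbases_cap_small bH bK sKx (subsetDl _ _)) ?eqxx // in nHK.
  by rewrite /d -cK (cardsD1 x K) xK.
move: (setU11 x H); rewrite e in_setU1 -eHK (negPf xH) orbF => /eqP ->.
by rewrite eHK.
Qed.

(** * Contraction by a small flat *)

Section Contraction.

Variable F : {set T}.
Hypotheses (sF : F \subset E) (cF : (#|F|.+1 < d)%N).

Let rF : rk M F = #|F|.
Proof. by have [u1 _] := uM sF; rewrite u1 -/d; lia. Qed.

Lemma uniform_off_rank_contract : uniform_off_rank (contract M F).
Proof.
move=> A /=; rewrite subsetD => /andP[sA dA]; rewrite rank_contract contractE rF.
have sAF : A :|: F \subset E by rewrite subUset sA.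
have cAF : #|A :|: F| = (#|A| + #|F|)%N.
  by rewrite cardsU disjoint_setI0 // cards0 subn0.
have [u1 u2] := uM sAF; rewrite cAF in u1 u2.
by split=> h; [rewrite u1|rewrite u2]; lia.
Qed.

Lemma card_nonbases_contract : #|nonbases (contract M F)| = nonbases_over M F.
Proof.
rewrite /nonbases_over -(card_in_imset (f := fun H => H :\: F)
                        (D := [set H in nonbases M | F \subset H])); last first.
  move=> H1 H2; rewrite !in_set => /andP[_ s1] /andP[_ s2] e.
  by rewrite -(setID H1 F) -(setID H2 F) e (setIidPr s1) (setIidPr s2).
apply: eq_card => A; apply/nonbasesP/imsetP => [[]|[H]].
  rewrite rank_contract contractE rF /= subsetD => /andP[sA dA] cA rA.
  have cAF : #|A :|: F| = (#|A| + #|F|)%N.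
    by rewrite cardsU disjoint_setI0 // cards0 subn0.
  exists (A :|: F); last by rewrite setDUl setDv setU0 (setDidPl _).
  rewrite in_set subsetUr andbT; apply/nonbasesP.
  by rewrite subUset sA sF cAF -/d; split=> //; lia.
rewrite in_set => /andP[bH sFH] ->; have /nonbasesP[sH cH rH] := bH.
rewrite rank_contract contractE rF /= setSD //.
have -> : H :\: F :|: F = H by rewrite setUC -{1}(setIidPr sFH) setID.
by rewrite cardsD (setIidPr sFH) cH -/d; split=> //; lia.
Qed.

End Contraction.

End UniformOffRank.

(** * The Kazhdan-Lusztig polynomial of a sparse paving matroid *)

Lemma rk_eq0_flat (T : finType) (M : matroid T) (F : {set T}) :
  loopless M -> F \in flats M -> (rk M F == 0%N) = (F == set0).
Proof.
move=> lM fF; apply/idP/idP => [/eqP r0|/eqP ->]; last by rewrite rk0.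
apply: contraT => nzF; have pF : set0 \proper F by rewrite properEneq eq_sym nzF sub0set.
by have := rk_lt_flat (flat0 lM) pF (flats_sub fF); rewrite r0 ltn0.
Qed.

Lemma rk_eq_rank_flat (T : finType) (M : matroid T) (F : {set T}) :
  F \in flats M -> (rk M F == rank M) = (F == ground M).
Proof.
move=> fF; apply/eqP/eqP => [rF|-> //]; apply/eqP.
rewrite eqEproper flats_sub //=; apply/negP => pF.
by have := rk_lt_flat fF pF (subxx _); rewrite rF ltnn.
Qed.

Lemma kl_poly_rank0 (T : finType) (M : matroid T) : rank M = 0%N -> kl_poly M = 1.
Proof. by rewrite /kl_poly => ->. Qed.

Lemma size_kl_poly (T : finType) (M : matroid T) :
  loopless M -> (0 < rank M)%N -> (size (kl_poly M) <= uphalf (rank M))%N.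
Proof.
move=> lM r0; rewrite -degree_bound //.
by have [_ /(_ r0)] := kl_poly_axioms lM.
Qed.

(** Only the empty flat contributes to the constant term of [zpoly M], and only the ground set to
    its top coefficient; palindromicity equates the two. *)
Lemma kl_poly_coef0 (T : finType) (M : matroid T) :
  loopless M -> (kl_poly M)`_0 = 1.
Proof.
move=> lM; have := zpoly_palindromic lM (leq0n _).
rewrite subn0 /zpoly !coef_sum (bigD1 set0) ?flat0 //= rk0 mul1r contract0.
rewrite big1 ?addr0 => [->|F /andP[fF nzF]]; last first.
  by rewrite coefXnM lt0n rk_eq0_flat // nzF.
rewrite (bigD1 (ground M)) ?flat_ground //= coefXnM -/(rank M) ltnn subnn.
rewrite kl_poly_rank0 ?rank_contract ?subnn // coef1 big1 ?addr0 // => F.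
move=> /andP[fF nF]; have ltF : (rk M F < rank M)%N.
  by rewrite ltn_neqAle rk_eq_rank_flat // nF rkS ?flats_sub.
rewrite coefXnM ltnNge ltnW //= nth_default // -rank_contract.
apply: leq_trans (uphalf_le _); apply: size_kl_poly.
  exact: loopless_contract.
by rewrite rank_contract subn_gt0.
Qed.

Lemma kl_poly_rank1 (T : finType) (M : matroid T) :
  loopless M -> rank M = 1%N -> kl_poly M = 1.
Proof.
move=> lM r1; have := size_kl_poly lM; rewrite r1 => /(_ isT) /size1_polyC ->.
by rewrite kl_poly_coef0.
Qed.

Definition klq (T : finType) (M : matroid T) : {poly rat} :=
  map_poly intr (kl_poly M).

Definition flat_layer (T : finType) (M : matroid T) (k : nat) : {poly rat} :=
  \sum_(F in flats M | rk M F == k) klq (contract M F).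

Lemma map_zpoly (T : finType) (M : matroid T) :
  map_poly intr (zpoly M) =
  \sum_(k < (rank M).+1) 'X^k * flat_layer M k :> {poly rat}.
Proof.
rewrite rmorph_sum /=.
rewrite (partition_big (fun F => inord (rk M F) : 'I_(rank M).+1) xpredT) //=.
apply: eq_bigr => k _; rewrite mulr_sumr; apply: eq_big => F.
  case fF: (F \in flats M) => //=; rewrite -val_eqE /= inordK //.
  by rewrite ltnS rkS ?flats_sub.
move=> /andP[fF /eqP <-]; rewrite rmorphM /= map_polyXn inordK //.
by rewrite ltnS rkS ?flats_sub.
Qed.

Lemma flat_layer0 (T : finType) (M : matroid T) :
  loopless M -> flat_layer M 0 = klq M.
Proof.
move=> lM; rewrite /flat_layer (big_pred1 set0) ?contract0 // => F /=.
apply/andP/eqP => [[fF]|->]; last by rewrite flat0 // rk0.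
by rewrite rk_eq0_flat // => /eqP.
Qed.

Lemma flat_layer_rank (T : finType) (M : matroid T) : flat_layer M (rank M) = 1.
Proof.
rewrite /flat_layer (big_pred1 (ground M)) => [|F /=].
  by rewrite /klq kl_poly_rank0 ?rmorph1 // rank_contract subnn.
apply/andP/eqP => [[fF]|->]; last by rewrite flat_ground /rank.
by rewrite rk_eq_rank_flat // => /eqP.
Qed.

Lemma flat_layer_hyperplanes (T : finType) (M : matroid T) :
  (0 < rank M)%N ->
  flat_layer M (rank M).-1 = #|[set F in flats M | rk M F == (rank M).-1]|%:R.
Proof.
move=> r0; rewrite -sum1_card natr_sum /flat_layer.
apply: eq_big => F; first by rewrite [RHS]in_set.
move=> /andP[fF /eqP rF]; rewrite /klq kl_poly_rank1 ?rmorph1 //.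
  exact: loopless_contract.
by rewrite rank_contract rF; lia.
Qed.

(** A nonzero coefficient below degree d / 2 would have a mirror image above it. This is how
    palindromicity determines the Kazhdan-Lusztig polynomial. *)
Lemma palindromic_eq0 (R : nzRingType) (p : {poly R}) d :
  (size p <= uphalf d)%N -> (forall j, (j <= d)%N -> p`_j = p`_(d - j)) -> p = 0.
Proof.
move=> sp pal; apply/polyP=> j; rewrite coef0.
have [le|lt] := leqP (uphalf d) j; first by rewrite nth_default ?(leq_trans sp).
have led := uphalf_le d; rewrite pal ?nth_default //; last by lia.
apply: leq_trans sp _; move: lt; rewrite ltn_uphalf leq_uphalf_double; lia.
Qed.

(** Induction on the rank fixes all layers of positive rank, so [zpoly M] is the expected
    palindromic polynomial plus an error from layer 0. That error is palindromic and obeys the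
    degree bound, hence is zero. *)
Lemma klq_sparse_paving (T : finType) (M : matroid T) (m : nat) :
  loopless M -> uniform_off_rank M -> (0 < m)%N -> (0 < rank M)%N ->
  #|ground M| = (m + rank M)%N ->
  klq M = unif_poly m (rank M) - #|nonbases M|%:R *:
            (unif_poly 1 (rank M) - unif_poly 1 (rank M).-1).
Proof.
have [n] := ubnP (rank M); elim: n M => // n IH M ltMn lM uM m0 r0 cE.
case def_d: (rank M) r0 => [//|d] _; set lam := #|nonbases M|.
(* [t k] is the expected layer of rank [k]: uniform contractions, corrected by [v k] once for each
   [k]-subset of each nonbasis. *)
pose v k : {poly rat} := unif_poly 1 (d.+1 - k) - unif_poly 1 (d - k).
pose t k : {poly rat} := 'C(m + d.+1, k)%:R *: unif_poly m (d.+1 - k) -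
            (lam * 'C(d.+1, k))%N%:R *: v k.
have layerE k : (0 < k <= d)%N ->
    flat_layer M k = t k - ((k == d) * (lam * d))%N%:R%:P.
  case/andP=> k0; rewrite leq_eqVlt => /orP[/eqP ->|ltkd]; last first.
    rewrite ltn_eqF // mul0n subr0.
    rewrite /flat_layer (eq_bigl (fun F => F \in
      [set F : {set T} | (F \subset ground M) && (#|F| == k)])); last first.
      by move=> F; rewrite in_set -small_flatE // def_d ltnS.
    transitivity (\sum_(F in [set F : {set T} | (F \subset ground M) && (#|F| == k)])
        (unif_poly m (d.+1 - k) - (nonbases_over M F)%:R *: v k)).
      apply: eq_bigr => F; rewrite in_set => /andP[sF /eqP cF].
      have cFd : (#|F|.+1 < rank M)%N by rewrite cF def_d.
      have fF := small_flat uM sF cFd.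
      have rF : rk M F = k by have [u1 _] := uM _ sF; rewrite u1 ?cF // def_d; lia.
      have rC : rank (contract M F) = (d.+1 - k)%N by rewrite rank_contract def_d rF.
      rewrite (IH (contract M F)) ?rC ?card_nonbases_contract //.
      - by rewrite /v subSn ?subSKn // ltnW.
      - by lia.
      - exact: loopless_contract.
      - exact: uniform_off_rank_contract.
      - by lia.
      - by rewrite /= cardsD (setIidPr sF) cE cF def_d; lia.
    rewrite sumrB sumr_const cards_draws cE def_d -scaler_nat; congr (_ - _).
    by rewrite -scaler_suml -natr_sum sum_nonbases_over // def_d.
  (* In the hyperplane layer [v d] vanishes and every contraction has polynomial 1, so the layer is
     a count. *)
  have := flat_layer_hyperplanes (M := M); rewrite def_d => /(_ isT) -> /=.
  have := @card_hyperplanes _ _ uM; rewrite def_d /= cE def_d => /(_ isT).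
  move=> /(congr1 (fun k => k%:R : {poly rat})); rewrite !natrD !natrM => e.
  rewrite eqxx mul1r /t /v subnn subSnn !unif_poly1 // subrr scaler0 subr0.
  rewrite scaler_nat rmorphM /= !rmorph_nat.
  move: e; rewrite -/lam -natr1 => e.
  by rewrite -[LHS](addrK (lam%:R * (d%:R + 1))) e; ring.
have zE : map_poly intr (zpoly M) = klq M - t 0%N +
    (unif_zpoly m d.+1 - lam%:R *: relax_zpoly d).
  rewrite map_zpoly def_d big_ord_recr /= -def_d flat_layer_rank def_d mulr1.
  transitivity (\sum_(k < d.+1) ('X^k * t k) - (lam * d)%N%:R *: 'X^d
                + (klq M - t 0%N) + 'X^(d.+1)).
    congr (_ + _).
    rewrite (eq_bigr (fun k : 'I_d.+1 => 'X^k * t k +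
      ((k == 0%N :> nat)%:R * (klq M - t 0%N) -
       (k == d :> nat)%:R * ((lam * d)%N%:R *: 'X^d)))).
      rewrite big_split sumrB /= [in LHS]addrA addrAC; congr (_ - _ + _).
      - rewrite (bigD1 ord_max) //= eqxx mul1r big1 ?addr0 // => k nk.
        by rewrite -val_eqE /= in nk; rewrite (negPf nk) mul0r.
      - rewrite (bigD1 ord0) //= mul1r big1 ?addr0 // => k nk.
        by rewrite -val_eqE /= in nk; rewrite (negPf nk) mul0r.
    move=> k _; have lekd : (k <= d)%N by rewrite -ltnS.
    have [k0|k0] := posnP k.
      rewrite k0 flat_layer0 // !mul1r.
      (* For [d = 0] the layers 0 and [d] coincide, but then [lam * d] is zero. *)
      have -> : (0%N == d)%:R * ((lam * d)%N%:R *: 'X^d) = 0 :> {poly rat}.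
        by case: (d) => [|d']; rewrite ?muln0 ?scale0r ?mulr0 ?mul0r.
      by rewrite subr0 addrC subrK.
    rewrite layerE ?k0 // mul0r add0r mulrBr; congr (_ - _).
    case: eqP => [->|_]; last by rewrite mul0n mulr0 mul0r.
    by rewrite mul1n mul1r mulrC mul_polyC.
  have -> : \sum_(k < d.+1) 'X^k * t k =
      \sum_(k < d.+1) 'C(m + d.+1, k)%:R *: ('X^k * unif_poly m (d.+1 - k)) -
      lam%:R *: \sum_(k < d.+1) 'C(d.+1, k)%:R *: ('X^k * v k).
    rewrite scaler_sumr -sumrB; apply: eq_bigr => k _.
    by rewrite /t mulrBr natrM -!scalerAr scalerA.
  rewrite relax_zpolyE scalerDr scalerA -natrM /unif_zpoly -/v.
  by ring.
have D0 : klq M - t 0%N = 0.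
  apply: (@palindromic_eq0 _ _ d.+1) => [|j lej].
    have su m' k : (k <= d.+1)%N -> (size (unif_poly m' k) <= uphalf d.+1)%N.
      case: k => [|k] le; first by rewrite size_poly1.
      by apply: (leq_trans (size_unif_poly _ _)) => //; exact: uphalf_leq.
    rewrite (leq_trans (size_polyD _ _)) // geq_max size_polyN; apply/andP; split.
      rewrite (leq_trans (size_poly _ _)) // -def_d size_kl_poly //.
      by rewrite def_d.
    rewrite (leq_trans (size_polyD _ _)) // geq_max size_polyN.
    rewrite !(leq_trans (size_scale_leq _ _)) ?su ?leq_subr //.
    rewrite (leq_trans (size_polyD _ _)) // geq_max size_polyN.
    by rewrite !subn0 !su.
  have e i : (klq M - t 0%N)`_i = (map_poly intr (zpoly M))`_i -
     ((unif_zpoly m d.+1)`_i - lam%:R * (relax_zpoly d)`_i).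
    by rewrite zE [in RHS]coefD -coefZ -(coefB (unif_zpoly m d.+1)) addrK.
  rewrite !e !coef_map /= zpoly_palindromic ?def_d // unif_zpoly_palindromic //.
  by rewrite [in LHS]relax_zpoly_palindromic.
move/eqP: D0; rewrite subr_eq0 => /eqP ->.
by rewrite /t /v !subn0 !bin0 scale1r muln1.
Qed.

(** * The leading coefficient *)

(** Cancelling [lambda] turns each bound into an inequality in [m] and [e]. For [m > 1] these give
    [e (e + 1) <= m] and [m^2 <= 3 m + 2 (e + 1)]; then [e >= 2] would force both [m >= 6] and
    [m <= 4]. *)
Lemma bound_odd (m e N lambda : nat) : (0 < m)%N -> (0 < e)%N ->
  (lambda * m.+1 <= N)%N -> (lambda * e.*2.+2 <= N)%N -> (0 < lambda)%N ->
  (lambda * (2 * ((m + e) * (m + e).+1)) = N * (m * e.+2))%N ->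
  m = 1%N \/ e = 1%N /\ (1 < m <= 4)%N.
Proof.
move=> m0 e0 b1 b2 l0 eq.
have h1 : (m.+1 * (m * e.+2) <= 2 * ((m + e) * (m + e).+1))%N.
  by rewrite -(leq_pmul2l l0) eq mulnA leq_mul2r b1 orbT.
have h2 : (e.*2.+2 * (m * e.+2) <= 2 * ((m + e) * (m + e).+1))%N.
  by rewrite -(leq_pmul2l l0) eq mulnA leq_mul2r b2 orbT.
have [->|m1] := eqVneq m 1%N; [by left|right].
have [x mx x0] : exists2 x, m = x.+1 & (0 < x)%N by exists m.-1; lia.
have h3 : (e * e.+1 <= m)%N.
  rewrite -(leq_pmul2l x0).
  have : (e.*2.+2 * (m * e.+2) + 2 * (x * m) =
    2 * ((m + e) * (m + e).+1) + 2 * (x * (e * e.+1)))%N.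
    by rewrite mx -addnn; ring.
  by move: h2; clear; lia.
have h4 : (m * m <= 3 * m + 2 * e.+1)%N.
  rewrite -(leq_pmul2l e0).
  have : (m.+1 * (m * e.+2) + e * (3 * m + 2 * e.+1) =
    2 * ((m + e) * (m + e).+1) + e * (m * m))%N by ring.
  by move: h1; clear; lia.
have [e1|e2] := leqP e 1.
  split; first by lia.
  rewrite mx ltnS x0 -mx /= leqNgt; apply/negP => m5.
  have : (5 * m <= m * m)%N by rewrite leq_mul2r m5 orbT.
  by lia.
have : (2 * e.+1 <= e * e.+1)%N by rewrite leq_mul2r e2 orbT.
have : (6 * m <= m * m)%N.
  rewrite leq_mul2r; apply/orP; right; apply: leq_trans h3.
  exact: (leq_mul e2 (e2 : (2 < e.+1)%N)).
by lia.
Qed.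

Lemma bound_even (m e N lambda : nat) : (0 < m)%N -> (0 < N)%N ->
  (lambda * m.+1 <= N)%N -> (lambda * (2 * e + 3) <= N)%N ->
  (lambda * (2 * e * (e + 2) * ((m + e) * (m + e + 1) * (m + e + 2))) <
   N * (m * (e * (m + e + 2) + 2) * ((e + 1) * (e + 3))))%N.
Proof.
move=> m0 N0 b1 b2.
have [->|l0] := posnP lambda.
  by rewrite mul0n !muln_gt0 N0 m0 /=; lia.
set A := (2 * e * _ * _)%N; set B := (m * _ * _)%N.
suff [h|h] : (A < m.+1 * B)%N \/ (A < (2 * e + 3) * B)%N.
- apply: (@leq_trans (lambda * (m.+1 * B))); first by rewrite ltn_pmul2l.
  by rewrite mulnA leq_mul2r b1 orbT.
- apply: (@leq_trans (lambda * ((2 * e + 3) * B))); first by rewrite ltn_pmul2l.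
  by rewrite mulnA leq_mul2r b2 orbT.
rewrite {}/A {}/B {b1 b2 N0 l0}.
(* The second alternative serves for [m <= e + 4], except at [m = 5], [e = 1], where it fails (2016
   against 2000); the first serves there and for larger [m]. *)
have [/andP[/eqP -> /eqP ->]|nme] := boolP ((m == 5) && (e == 1)); first by left.
have [le|lt] := leqP m (e + 4); [right|left].
  case: e le nme => [|[|e]] le nme; first by rewrite !muln0 !mul0n; lia.
    by case: m m0 nme le => [|[|[|[|[|[|m]]]]]] //; lia.
  move: le {nme}; set f := e.+2 => le.
  have key : (2 * (f + 2) * ((m + f) * (m + f + 1)) <=
              (2 * f + 3) * m * ((f + 1) * (f + 3)))%N.
    have [x mx] : exists x, m = x.+1 by exists m.-1; lia.
    have : (2 * (f + 2) * (x * x) <= 2 * (f + 2) * (x * (f + 3)))%N.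
      by rewrite leq_mul2l leq_mul2l; lia.
    have : ((2 * f + 3) * m * ((f + 1) * (f + 3)) + 2 * (f + 2) * (x * x) =
        2 * (f + 2) * ((m + f) * (m + f + 1)) + 2 * (f + 2) * (x * (f + 3)) +
        ((f + 1) * (f + 1) +
         x * (2 * (e * e * e) + 17 * (e * e) + 38 * e + 9)))%N.
      by rewrite mx /f; ring.
    by clear; lia.
  (* [key] is the comparison without the common factor [f * (m + f + 2)]; the added 2 in the right
     side makes it strict. *)
  have -> : (2 * f * (f + 2) * ((m + f) * (m + f + 1) * (m + f + 2)) =
    2 * (f + 2) * ((m + f) * (m + f + 1)) * (f * (m + f + 2)))%N by ring.
  have -> : ((2 * f + 3) * (m * (f * (m + f + 2) + 2) * ((f + 1) * (f + 3))) =
    (2 * f + 3) * m * ((f + 1) * (f + 3)) * (f * (m + f + 2)) +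
    2 * ((2 * f + 3) * m * ((f + 1) * (f + 3))))%N by ring.
  rewrite -addn1 leq_add // ?leq_mul2r ?key ?orbT //.
  by rewrite !muln_gt0 m0 !addn_gt0 !orbT.
case: e lt {nme} => [|e] lt; first by rewrite !muln0 !mul0n; lia.
have [x mx] : exists x, m = (e + 6 + x)%N by exists (m - (e + 6))%N; lia.
set f := e.+1.
have key : (2 * (f + 2) * ((m + f) * (m + f + 1)) <=
            m.+1 * m * ((f + 1) * (f + 3)))%N.
  have -> : (m.+1 * m * ((f + 1) * (f + 3)) =
    2 * (f + 2) * ((m + f) * (m + f + 1)) +
    (e ^ 4 + 11 * e ^ 3 + 44 * e ^ 2 + 64 * e +
     x * (e ^ 3 + 7 * e ^ 2 + 14 * e + 2) +
     (e + 6 + x) * (e ^ 2 + 4 * e + 2) * x))%N.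
    by rewrite mx /f; ring.
  exact: leq_addr.
have -> : (2 * f * (f + 2) * ((m + f) * (m + f + 1) * (m + f + 2)) =
  2 * (f + 2) * ((m + f) * (m + f + 1)) * (f * (m + f + 2)))%N by ring.
have -> : (m.+1 * (m * (f * (m + f + 2) + 2) * ((f + 1) * (f + 3))) =
  m.+1 * m * ((f + 1) * (f + 3)) * (f * (m + f + 2)) +
  2 * (m.+1 * m * ((f + 1) * (f + 3))))%N by ring.
rewrite -addn1 leq_add // ?leq_mul2r ?key ?orbT //.
by rewrite !muln_gt0 m0 !addn_gt0 !orbT.
Qed.
(** For rank [d = a + i] this exhibits the factor ['C(m + d, d)] that also bounds the number of
    nonbases. *)
Lemma unif_coefE m a i :
  unif_coef m a i = 'C(m + (a + i), a + i)%:R * 'C(a + i, i)%:R * unif_trans m a i.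
Proof.
congr (_ * _); rewrite -!natrM; congr _%:R.
have := @bin_mul_bin (m + (a + i)) (a + i) a ltac:(lia).
rewrite addKn addnK -(@bin_sub (a + i) i) ?leq_addl // addnK => <-.
by rewrite -(@bin_sub (m + a) m) ?leq_addr // addKn [(m + (a + i))%N]addnC.
Qed.

(** With n = m + d, the two counts are converted by [d * 'C(n, d) = m.+1 * 'C(n, d.-1)] and
    [d.+1 * 'C(n, d.+1) = m * 'C(n, d)]. *)
Lemma nonbases_card_bounds (T : finType) (M : matroid T) (m : nat) :
  uniform_off_rank M -> (0 < m)%N -> (0 < rank M)%N ->
  #|ground M| = (m + rank M)%N ->
  (#|nonbases M| * m.+1 <= 'C(m + rank M, rank M))%N /\
  (#|nonbases M| * (rank M).+1 <= 'C(m + rank M, rank M))%N.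
Proof.
move=> uM m0 r0 cE; have b1 := nonbases_bound uM; have b2 := nonbases_bound_dual uM.
move: b1 b2; rewrite cE addnK => b1 b2; split.
  rewrite -(leq_pmul2l r0) -[X in (_ <= X * 'C(_, X))%N](prednK r0) mul_bin_left.
  have -> : (m + rank M - (rank M).-1 = m.+1)%N by lia.
  by rewrite mulnA [X in (_ <= X)%N]mulnC leq_mul2r mulnC b1 orbT.
rewrite -(leq_pmul2l m0).
have := mul_bin_left (m + rank M) (rank M); rewrite addnK => <-.
by rewrite mulnA [X in (_ <= X)%N]mulnC leq_mul2r mulnC b2 orbT.
Qed.

(** * Degeneracy according to the parity of the rank *)

Lemma nondegenerate_coef (T : finType) (M : matroid T) :
  loopless M -> (0 < rank M)%N ->
  Defs.nondegenerate M = ((klq M)`_((rank M).-1./2) != 0).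
Proof.
move=> lM r0; rewrite coef_map /= intr_eq0 /Defs.nondegenerate eqn_leq.
have -> : (size (kl_poly M) <= ((rank M).-1./2).+1)%N.
  by apply: (leq_trans (size_kl_poly lM r0)); rewrite uphalfE; lia.
rewrite andTb; apply/idP/idP => [lt|]; last by rewrite ltnNge; apply: contra => /leq_sizeP ->.
have sz : size (kl_poly M) = ((rank M).-1./2).+1.
  apply/eqP; rewrite eqn_leq lt andbT.
  by apply: (leq_trans (size_kl_poly lM r0)); rewrite uphalfE; lia.
have := lead_coef_eq0 (kl_poly M); rewrite lead_coefE sz /= => ->.
by rewrite -size_poly_eq0 sz.
Qed.

Lemma degenerate_odd (T : finType) (M : matroid T) (m e : nat) :
  loopless M -> uniform_off_rank M -> (0 < m)%N -> (0 < e)%N ->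
  rank M = e.*2.+1 -> #|ground M| = (m + rank M)%N ->
  degenerate M = (#|nonbases M| * (2 * ((m + e) * (m + e).+1)) ==
                  'C(m + rank M, rank M) * (m * e.+2))%N.
Proof.
move=> lM uM m0 e0 rM cE; have r0 : (0 < rank M)%N by rewrite rM.
rewrite /degenerate nondegenerate_coef // negbK (klq_sparse_paving lM uM m0) //.
set lam := #|nonbases M|; set N := 'C(m + rank M, rank M).
have -> : ((rank M).-1./2 = e)%N by rewrite rM /= doubleK.
(* The uniform polynomial of rank [e.*2] has degree below [e], so it drops out. *)
rewrite coefB coefZ coefB [X in _ - (_ * (_ - X))]nth_default; last first.
  by rewrite rM /= (leq_trans (size_unif_poly _ _)) ?double_gt0 ?uphalf_double.
rewrite !coef_unif_poly; try by rewrite rM -addnn; lia.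
have -> : (rank M - e = e.+1)%N by rewrite rM -addnn; lia.
rewrite !unif_coefE !unif_trans_top //.
have -> : (e.+1 + e = rank M)%N by rewrite rM -addnn.
rewrite add1n binSn -/N !add1n subr0.
have B0 : 'C(rank M, e)%:R != 0 :> rat.
  by rewrite pnatr_eq0 -lt0n bin_gt0 rM -addnn; lia.
move: B0; move: ('C(rank M, e)%:R : rat) => B B0.
have z1 : (m + e)%:R != 0 :> rat by rewrite pnatr_eq0; lia.
have z2 : (m + e).+1%:R != 0 :> rat by rewrite pnatr_eq0.
have z3 : e.+1%:R != 0 :> rat by rewrite pnatr_eq0.
have z4 : e.+2%:R != 0 :> rat by rewrite pnatr_eq0.
have -> : (rank M).+1%:R = 2%:R * e.+1%:R :> rat.
  by rewrite -natrM rM mul2n -doubleS.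
rewrite -(eqr_nat rat) !natrM.
move: z1 z2 z3 z4; move: ((m + e)%:R : rat) ((m + e).+1%:R : rat) (e.+1%:R : rat).
move: (e.+2%:R : rat) (N%:R : rat) (lam%:R : rat) (m%:R : rat).
move=> E2 n l x y y1 E1 z1 z2 z3 z4.
have -> : n * B * (x / (y * y1)) - l * (2%:R * E1 * B * (1 / (E1 * E2))) =
   (n * (x * E2) - l * (2%:R * (y * y1))) * (B / (y * y1 * E2)).
  by field; rewrite z1 z2 z3 z4.
have nz : B / (y * y1 * E2) != 0 by rewrite mulf_neq0 // invr_eq0 !mulf_neq0.
by rewrite mulf_eq0 (negPf nz) orbF subr_eq0 eq_sym.
Qed.

Lemma nondegenerate_even (T : finType) (M : matroid T) (m e : nat) :
  loopless M -> uniform_off_rank M -> (0 < m)%N ->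
  rank M = e.*2.+2 -> #|ground M| = (m + rank M)%N -> Defs.nondegenerate M.
Proof.
move=> lM uM m0 rM cE; have r0 : (0 < rank M)%N by rewrite rM.
have [b1 b2] := nonbases_card_bounds uM m0 r0 cE.
rewrite nondegenerate_coef // (klq_sparse_paving lM uM m0) //.
move: b1 b2; set lam := #|nonbases M|; set N := 'C(m + rank M, rank M) => b1 b2.
have {}b2 : (lam * (2 * e + 3) <= N)%N by move: b2; rewrite rM -mul2n addn3.
have N0 : (0 < N)%N by rewrite bin_gt0 leq_addl.
have := bound_even m0 N0 b1 b2 => {b1 b2 N0}.
have -> : ((rank M).-1./2 = e)%N by rewrite rM /= uphalf_double.
rewrite coefB coefZ coefB !coef_unif_poly; try by rewrite rM -addnn /=; lia.
have -> : (rank M - e = e.+2)%N by rewrite rM -addnn; lia.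
have -> : ((rank M).-1 - e = e.+1)%N by rewrite rM -addnn /=; lia.
rewrite !unif_coefE !unif_trans_top // !unif_trans_subtop // !add1n !binSn.
have -> : (e.+2 + e = rank M)%N by rewrite rM -addnn.
(* Brings the term of rank [e.*2.+1] over the binomial ['C(rank M, e)] shared by the other two. *)
have eB : (e.+1 + e).+1%:R * 'C(e.+1 + e, e)%:R = e.+2%:R * 'C(rank M, e)%:R :> rat.
  rewrite -!natrM; congr _%:R; have := mul_bin_down (rank M) e.
  by rewrite rM -addnn /= => ->; congr (_ * _)%N; lia.
rewrite eB -/N => {eB}.
have B0 : 0 < 'C(rank M, e)%:R :> rat.
  by rewrite ltr0n bin_gt0 rM -addnn; lia.
move: B0; move: ('C(rank M, e)%:R : rat) => B B0.
have -> : (rank M).+1%:R = 2 * e%:R + 3 :> rat.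
  by rewrite rM -(natrM _ 2) -natrD; congr _%:R; lia.
rewrite -(ltr_nat rat) -(@natr1 rat (m + e).+1) -(@natr1 rat (m + e)).
rewrite -(@natr1 rat e.+2) -(@natr1 rat e.+1) !(natrD, natrM) -(@natr1 rat e).
have x0 : 0 < m%:R :> rat by rewrite ltr0n.
have y0 : 0 <= e%:R :> rat by rewrite ler0n.
move: x0 y0; move: (N%:R : rat) (lam%:R : rat) (m%:R : rat) (e%:R : rat).
move=> n l x y x0 y0 lt.
set lhs := (X in X != 0); rewrite (_ : lhs = B *
  (n * (x * (y * (x + y + 2) + 2) * ((y + 1) * (y + 3))) -
   l * (2 * y * (y + 2) * ((x + y) * (x + y + 1) * (x + y + 2)))) /
  ((x + y) * (x + y + 1) * (x + y + 2) * ((y + 1) * (y + 3)))); last first.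
  rewrite /lhs; field; rewrite !gt_eqF //; lra.
apply/lt0r_neq0/divr_gt0.
  by rewrite mulr_gt0 // subr_gt0.
by rewrite !mulr_gt0 //; lra.
Qed.

Local Close Scope ring_scope.

Theorem theorem5p2 (T : finType) (M : matroid T) (m d lambda : nat) :
  1 <= m -> 1 <= d ->
  loopless M -> sparse_paving M ->
  rank M = d -> #|ground M| = m + d ->
  #|circuit_hyperplanes M| = lambda ->
  degenerate M <->
    [/\ m = 1, 3 <= d, odd d & lambda = 1] \/
    [/\ m = 4, d = 3 & lambda = 7].
Proof.
move=> m0 d0 lM /sparse_paving_uniform_off_rank uM rM cE.
rewrite circuit_hyperplanesE // => cL.
have cE' : #|ground M| = m + rank M by rewrite rM.
have r0 : 0 < rank M by rewrite rM.
have [b1 b2] := nonbases_card_bounds uM m0 r0 cE'.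
have [e de] : exists e, d = e.*2.+1 \/ d = e.*2.+2.
  by exists d.-1./2; have := odd_double_half d.-1; case: (odd _) => /=; lia.
case: de => de; last first.
  split; last by rewrite de => -[[_ _]|[_]] //=; rewrite ?odd_double //; lia.
  by rewrite /degenerate (nondegenerate_even (e := e) lM uM m0) ?rM.
(* In rank 1 the coefficient in question is the constant one, which is 1. *)
have [e0|e0] := posnP e.
  split; last by rewrite de e0 => -[[_]|[_]].
  rewrite /degenerate nondegenerate_coef // rM de e0 /= coef_map /=.
  by rewrite kl_poly_coef0.
rewrite (degenerate_odd (e := e) lM uM m0 e0) ?rM // cL.
rewrite rM cL in b1 b2; set N := 'C(m + d, d) in b1 b2 *.
split=> [/eqP eqN|[[m1 _ _ l1]|[m4 d3 l7]]]; last 2 first.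
- by rewrite /N l1 m1 add1n binSn de -addnn; apply/eqP; ring.
- have e1 : e = 1 by lia.
  by rewrite /N m4 d3 l7 e1.
have N0 : 0 < N by rewrite bin_gt0 leq_addl.
have l0 : 0 < lambda.
  rewrite lt0n; apply/eqP => l0; move: eqN; rewrite l0 mul0n => /esym/eqP.
  by rewrite !muln_eq0; lia.
have b2' : lambda * e.*2.+2 <= N by rewrite -de.
case: (bound_odd m0 e0 b1 b2' l0 eqN) => [m1|[e1 m4]].
  left; split=> //; [lia|by rewrite de /= odd_double|].
  (* Here [N = d + 1 = 2 (e + 1)], and cancelling in the equation leaves [lambda = 1]. *)
  by move: b1 l0; rewrite /N m1 add1n binSn; move: eqN; rewrite /N m1 add1n binSn de -addnn; nia.
right; have d3 : d = 3 by rewrite de e1.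
move: eqN; rewrite /N d3 e1.
(* For [m = 2, 3, 4] the equation gives [lambda] the values 5/2, 9/2 and 7. *)
case: m m4 {m0 b1 b2 b2' cE cE' N N0} => [|[|[|[|[|m]]]]] // _.
- by rewrite (_ : 'C(2 + 3, 3) = 10) //; lia.
- by rewrite (_ : 'C(3 + 3, 3) = 20) //; lia.
- by rewrite (_ : 'C(4 + 3, 3) = 35) // => eqN; split=> //; lia.
Qed.
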